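(* There is a constant $c$ such that every simple 3-connected graph $G$ with $n$ vertices in which every vertex has degree at most $4$ has an orthogonal drawing of area at most $\frac{25}{36}n^2 + c\,n$.
   Context: A graph is 3-connected if it has more than $3$ vertices and, for any two vertices $u,v$, the graph $G-\{u,v\}$ is connected. An orthogonal drawing of a graph assigns: - to each vertex a distinct point with integer coordinates, and - to each edge a polygonal line connecting the points of its endpoints, all of whose segments are horizontal or vertical and whose bends lie at integer points. Edges may intersect, but only in single points that are not bends of the polygonal lines. If exactly $H$ horizontal lines and $W$ vertical lines of the integer grid intersect the drawing, the drawing has width $W$, height $H$, and area $H\cdot W$. *)

(* Defs.v *)
From mathcomp Require Import all_boot all_order all_algebra.
From mathcomp Require Import reals.
Set Implicit Arguments. Unset Strict Implicit. Unset Printing Implicit Defensive.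
Import Order.TTheory GRing.Theory Num.Theory.
Local Open Scope ring_scope.

Definition simple_graph (T : finType) (e : rel T) : Prop :=
  symmetric e /\ irreflexive e.

Definition max_degree_le (T : finType) (e : rel T) (k : nat) : Prop :=
  forall x : T, (#|[pred y | e x y]| <= k)%N.

Definition remove2 (T : finType) (e : rel T) (u v : T) : rel T :=
  [rel a b | [&& e a b, a != u, a != v, b != u & b != v]].

Definition three_connected (T : finType) (e : rel T) : Prop :=
  (3 < #|T|)%N /\
  forall u v x y : T, x != u -> x != v -> y != u -> y != v ->
    connect (remove2 e u v) x y.

Definition gpoint := (int * int)%type.

Definition polyline (T : finType) (pos : T -> gpoint) (route : T -> T -> seq gpoint)
  (x y : T) : seq gpoint := pos x :: rcons (route x y) (pos y).

Definition segs (p : seq gpoint) : seq (gpoint * gpoint) := zip p (behead p).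

Definition axis_seg (s : gpoint * gpoint) : bool :=
  (s.1.1 == s.2.1) != (s.1.2 == s.2.2).

Definition horizontal (s : gpoint * gpoint) : bool := s.1.2 == s.2.2.

Section Real.
Variable R : realType.

Definition rpt (a : gpoint) : R * R := (a.1%:~R, a.2%:~R).

Definition on_seg (s : gpoint * gpoint) (q : R * R) : Prop :=
  exists t : R, 0 <= t <= 1 /\
    q.1 = (s.1.1)%:~R + t * (s.2.1 - s.1.1)%:~R /\
    q.2 = (s.1.2)%:~R + t * (s.2.2 - s.1.2)%:~R.

Definition on_poly (p : seq gpoint) (q : R * R) : Prop :=
  exists2 s, s \in segs p & on_seg s q.

(* a valid orthogonal polygonal line: axis-parallel segments, every interior
   point is a genuine bend (consecutive segments alternate orientation), and
   the polyline is simple (non-consecutive segments are disjoint, consecutive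
   ones only share their common point) *)
Definition orth_polyline (p : seq gpoint) : Prop :=
  all axis_seg (segs p) /\
  (forall i, (i.+1 < size (segs p))%N ->
     horizontal (nth (0,0) (segs p) i) != horizontal (nth (0,0) (segs p) i.+1)) /\
  (forall i j (q : R * R), (i < j < size (segs p))%N ->
     on_seg (nth (0,0) (segs p) i) q -> on_seg (nth (0,0) (segs p) j) q ->
     j = i.+1 /\ q = rpt (nth (0,0) p j)).

Definition same_edge (T : finType) (x y x' y' : T) : bool :=
  ((x == x') && (y == y')) || ((x == y') && (y == x')).

Definition orth_drawing (T : finType) (e : rel T) (pos : T -> gpoint)
  (route : T -> T -> seq gpoint) : Prop :=
  injective pos /\
  (forall x y, e x y -> route y x = rev (route x y)) /\
  (forall x y, e x y -> orth_polyline (polyline pos route x y)) /\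
  (forall x y z, e x y -> z != x -> z != y ->
     ~ on_poly (polyline pos route x y) (rpt (pos z))) /\
  (forall x y x' y', e x y -> e x' y' -> ~~ same_edge x y x' y' ->
     (forall s s', s \in segs (polyline pos route x y) ->
        s' \in segs (polyline pos route x' y') ->
        forall q1 q2 : R * R, on_seg s q1 -> on_seg s' q1 ->
          on_seg s q2 -> on_seg s' q2 -> q1 = q2) /\
     (forall q : R * R, on_poly (polyline pos route x y) q ->
        on_poly (polyline pos route x' y') q ->
        q \notin map rpt (route x y) /\ q \notin map rpt (route x' y'))).

End Real.

Section Area.
Variables (T : finType) (e : rel T) (pos : T -> gpoint) (route : T -> T -> seq gpoint).

Definition all_points : seq gpoint :=
  [seq pos x | x <- enum T] ++
  flatten [seq route x y | x <- enum T, y <- [seq y <- enum T | e x y]].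

Definition all_segs : seq (gpoint * gpoint) :=
  flatten [seq segs (polyline pos route x y) | x <- enum T,
                                               y <- [seq y <- enum T | e x y]].

Definition minl (s : seq int) : int := foldr Num.min (head 0 s) s.
Definition maxl (s : seq int) : int := foldr Num.max (head 0 s) s.

Definition int_range (lo hi : int) : seq int :=
  [seq lo + (i%:Z) | i <- iota 0 (absz (hi - lo)).+1].

Definition hits_row (k : int) : bool :=
  has (fun a : gpoint => a.2 == k) all_points ||
  has (fun s : gpoint * gpoint =>
         (Num.min s.1.2 s.2.2 <= k) && (k <= Num.max s.1.2 s.2.2)) all_segs.

Definition hits_col (k : int) : bool :=
  has (fun a : gpoint => a.1 == k) all_points ||
  has (fun s : gpoint * gpoint =>
         (Num.min s.1.1 s.2.1 <= k) && (k <= Num.max s.1.1 s.2.1)) all_segs.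

(* number of horizontal grid lines meeting the drawing (all of them lie
   between the minimal and maximal y-coordinate of the drawing's points) *)
Definition drawing_height : nat :=
  let ys := map snd all_points in count hits_row (int_range (minl ys) (maxl ys)).

Definition drawing_width : nat :=
  let xs := map fst all_points in count hits_col (int_range (minl xs) (maxl xs)).

Definition drawing_area : nat := (drawing_height * drawing_width)%N.

End Area.

(* Main.v *)
(* Order the vertices greedily: repeatedly append a vertex with at least two neighbours in the
   current prefix, or else one with a single such neighbour. The cut of a prefix of i vertices is
   then at most 2i + 2, and it grows only when every remaining vertex has at most one neighbour in
   the prefix, that is, when it is at most n - i; so it never exceeds 2n/3 + O(1). Just before a
   vertex x is appended, the small components that its removal would leave behind are appended;
   this changes cuts by O(1) and leaves few vertices without a later neighbour.

   The vertices are drawn upwards in this order, in blocks of K consecutive rows. An edge runs in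
   a single column, from the row of its lower end to the row of its upper end, so the number of
   columns needed is the maximal cut plus O(K): a column is reused as soon as its edge has ended.
   At the start of a block each of its vertices reserves a window of four free columns. An edge
   leaving a vertex through its bottom port uses one row shared by the whole block, where windows
   keep such edges apart; a vertex with four earlier neighbours receives one of them through its
   top port, from the row above it, and closes its block. So (1 + O(1/K)) n rows and
   2n/3 + O(K) columns suffice, and 25/36 = (1 + 1/24) * 2/3. *)
From HB Require Import structures.
Require Import Defs.
From mathcomp Require Import all_boot all_order all_algebra.
From mathcomp Require Import reals.
From mathcomp Require Import zify lra.
Set Implicit Arguments. Unset Strict Implicit. Unset Printing Implicit Defensive.
Import Order.TTheory GRing.Theory Num.Theory.

(** * Axis-parallel segments *)

Local Open Scope ring_scope.

Section Segments.
Variable R : realType.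
Implicit Types (s : gpoint * gpoint) (q : R * R) (p : seq gpoint).

Definition between (a b : int) (x : R) : Prop :=
  (a%:~R <= x <= b%:~R) \/ (b%:~R <= x <= a%:~R).

Lemma on_seg_between s q :
  on_seg s q -> between s.1.1 s.2.1 q.1 /\ between s.1.2 s.2.2 q.2.
Proof.
case: s => [[a b] [c d]] [t [/andP[t0 t1]]] /= [-> ->]; rewrite !intrB.
by split; rewrite /between;
  [case: (lerP (a%:~R : R) c%:~R) | case: (lerP (b%:~R : R) d%:~R)] => h;
  [left|right|left|right]; apply/andP; split; nra.
Qed.

Lemma between_meet a b c d (x : R) : between a b x -> between c d x ->
  ~~ [|| [&& a < c, a < d, b < c & b < d] | [&& c < a, d < a, c < b & d < b]].
Proof.
move=> h1 h2; apply/negP => h; move: h1 h2; rewrite /between.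
have lti (m n : int) : m < n -> (m%:~R : R) < n%:~R by rewrite ltr_int.
by case/orP: h => /and4P[/lti h1 /lti h2 /lti h3 /lti h4] [] /andP[? ?] [] /andP[? ?]; lra.
Qed.

(** Strict separation of the bounding boxes in one coordinate, stated on the integer endpoints so
    that [lia] settles it for concrete polylines. *)
Definition apart s s' : bool :=
  [|| [&& s.1.1 < s'.1.1, s.1.1 < s'.2.1, s.2.1 < s'.1.1 & s.2.1 < s'.2.1],
      [&& s'.1.1 < s.1.1, s'.2.1 < s.1.1, s'.1.1 < s.2.1 & s'.2.1 < s.2.1],
      [&& s.1.2 < s'.1.2, s.1.2 < s'.2.2, s.2.2 < s'.1.2 & s.2.2 < s'.2.2] |
      [&& s'.1.2 < s.1.2, s'.2.2 < s.1.2, s'.1.2 < s.2.2 & s'.2.2 < s.2.2]].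

Lemma apart_disjoint s s' q : apart s s' -> on_seg s q -> on_seg s' q -> False.
Proof.
move=> h /on_seg_between[h1 h2] /on_seg_between[h1' h2'].
have := between_meet h1 h1'; have := between_meet h2 h2'.
by move: h; rewrite /apart => /or4P[] ->; rewrite ?orbT.
Qed.

(** Consecutive axis-parallel segments of different orientation meet only in their common corner, so
    separation has to be checked only for segments that are not consecutive. *)
Lemma orth_polyline_intro p :
  all axis_seg (segs p) ->
  (forall i, (i.+1 < size (segs p))%N ->
     horizontal (nth (0,0) (segs p) i) != horizontal (nth (0,0) (segs p) i.+1)) ->
  (forall i j, (i.+1 < j < size (segs p))%N ->
     apart (nth (0,0) (segs p) i) (nth (0,0) (segs p) j)) ->
  orth_polyline R p.
Proof.
move=> hax halt hap; split=> //; split=> // i j q /andP[ij js] hi hj.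
have [jE|ne] := eqVneq j i.+1; last first.
  by case: (apart_disjoint (hap i j _) hi hj); lia.
split=> //; subst j.
have szs : size (segs p) = (size p).-1.
  by rewrite size_zip size_behead; lia.
have nthE k : (k < size (segs p))%N -> nth (0,0) (segs p) k = (nth (0,0) p k, nth (0,0) p k.+1).
  by move=> hk; rewrite /segs nth_zip_cond -/(segs p) hk nth_behead.
have := halt _ js; have /all_nthP hax' := hax.
have := hax' (0,0) i (ltnW js); have := hax' (0,0) i.+1 js.
have [/on_seg_between hi' /on_seg_between hj'] := (hi, hj); move: hi' hj'.
rewrite !nthE ?(ltnW js) //.
move: (nth _ p i) (nth _ p i.+1) (nth _ p i.+2) => [a1 a2] [b1 b2] [c1 c2].
rewrite /axis_seg /horizontal /between /rpt /=; case: q {hi hj} => q1 q2 /=.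
move=> [h1 h2] [h3 h4].
have lin (a b : R) : a <= b <= a \/ a <= b <= a -> b = a by case=> /andP[? ?]; lra.
have [E1|N1] := eqVneq a2 b2; have [E2|N2] := eqVneq b2 c2;
  have [E3|N3] := eqVneq a1 b1; have [E4|N4] := eqVneq b1 c1 => //= _ _ _; subst;
  by congr pair; apply: lin.
Qed.

End Segments.

(** * Conflict-free layouts *)

Local Open Scope nat_scope.

Inductive port := PL | PR | PT | PB.

Definition nat_of_port (p : port) : nat :=
  match p with PL => 0 | PR => 1 | PT => 2 | PB => 3 end.

Lemma nat_of_port_inj : injective nat_of_port.
Proof. by case; case. Qed.

HB.instance Definition _ := Equality.copy port (inj_type nat_of_port_inj).

Section Layout.
Variables (T : finType) (e : rel T) (K : nat).
Variables (y lo X : T -> nat) (C : T -> T -> nat) (P : T -> T -> port).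
Variable Win : T -> pred nat.

(* [y v] is the row of [v], [lo v] the row shared by the block of [v], and [Win v] the columns
   reserved for [v]. The edge from [u] up to [w] runs in column [C u w] and uses the ports
   [P u w] of [u] and [P w u] of [w]: left, right, top or bottom. *)
Definition upward (u w : T) : bool := e u w && (y u < y w).
(** Half-open on purpose: an edge ending in row [r] still holds its column there, one starting in
    row [r] does not yet. A vertex can thus hand a column on from an incoming to an outgoing
    edge. *)
Definition active (r : nat) (u w : T) : bool := upward u w && (y u < r <= y w).

(** An edge using the top port of [v] turns in row [y v + 1]. The extra conditions keep that row and
    the piece above [v] free: [v] closes its block, no edge leaves it, and its column is held from
    below by the edge at its bottom port. *)
Definition in_spec (u v : T) : Prop :=
  match P v u with
  | PL => C u v < X v
  | PR => X v < C u v
  | PB => C u v = X v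
  | PT => [/\ C u v <> X v, (forall w, lo w = lo v -> y w <= y v),
              (forall w, ~~ upward v w) & exists2 u', upward u' v & P v u' = PB]
  end.

(** An edge using the bottom port descends to row [lo v], changes to its own column there and rises;
    both columns must be reserved for [v]. *)
Definition out_spec (v w : T) : Prop :=
  match P v w with
  | PL => C v w < X v /\ Win v (C v w)
  | PR => X v < C v w /\ Win v (C v w)
  | PT => C v w = X v
  | PB => [/\ C v w <> X v, Win v (C v w) & Win v (X v)]
  end.

(** The distance [K.+2] between blocks leaves room for the shared row, [K] vertex rows and one spare
    row for the bends at a top port. *)
Record layout : Prop := Layout {
  lay_inj : injective y;
  lay_lo : forall v, lo v < y v <= lo v + K;
  lay_block : forall u v, lo u < lo v -> lo u + K.+2 <= lo v;
  lay_active : forall z u w u' w', active (y z) u w -> active (y z) u' w' ->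
    C u w = C u' w' -> (u, w) = (u', w');
  lay_window : forall z v u w, active (y z) u w -> lo z = lo v -> y z <= y v ->
    ~~ Win v (C u w);
  lay_sep : forall u v a b, lo u = lo v -> y u < y v -> Win u a -> Win v b -> a < b;
  lay_port : forall v w w', e v w -> e v w' -> P v w = P v w' -> w = w';
  lay_in : forall u v, upward u v -> in_spec u v;
  lay_out : forall v w, upward v w -> out_spec v w;
  lay_col : forall v, Win v (X v) \/ exists2 u, upward u v & P v u = PB
}.

Hypothesis esym : symmetric e.
Hypothesis L : layout.

Definition row_start (u w : T) : nat := if P u w is PB then lo u else y u.
Definition row_end (u w : T) : nat := if P w u is PT then (y w).+1 else y w.

(** The integer points on the vertical pieces of a drawn edge: the stub under [u], the main column,
    the stub over [w]. *)
Definition vcovers (u w : T) (x r : nat) : Prop :=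
  [\/ [/\ P u w = PB, x = X u & lo u <= r <= y u],
      x = C u w /\ row_start u w <= r <= row_end u w |
      [/\ P w u = PT, x = X w & y w <= r <= (y w).+1]].

Definition joint (u w u' w' : T) (x r : nat) : Prop :=
  exists2 v, v \in [:: u; w] /\ v \in [:: u'; w'] & x = X v /\ r = y v.

Lemma jointC u w u' w' x r : joint u w u' w' x r -> joint u' w' u w x r.
Proof. by case=> v []; exists v. Qed.

Lemma row_startP u w : upward u w ->
  lo u <= row_start u w <= y u /\
  (row_start u w <> y u -> [/\ P u w = PB, row_start u w = lo u,
                             Win u (C u w) & Win u (X u)]).
Proof.
move=> h; rewrite /row_start; have := lay_out L h; rewrite /out_spec.
have := lay_lo L u; case: (P u w) => lu s; (split; [lia|move=> ne]); try by case: ne.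
by case: s.
Qed.

Lemma row_endP u w : upward u w ->
  y w <= row_end u w <= (y w).+1 /\
  (row_end u w <> y w -> P w u = PT /\ forall z, lo z = lo w -> y z <= y w).
Proof.
move=> h; rewrite /row_end; have := lay_in L h; rewrite /in_spec.
case: (P w u) => s; (split; [lia|move=> ne]); try by case: ne.
by split=> //; case: s.
Qed.

Lemma win_inj u v a : lo u = lo v -> Win u a -> Win v a -> u = v.
Proof.
move=> l hu hv; apply: (lay_inj L).
case: (ltngtP (y u) (y v)) => // h.
  by have := lay_sep L l h hu hv; lia.
by have := lay_sep L (Logic.eq_sym l) h hv hu; lia.
Qed.

Lemma up_lt u w : upward u w -> y u < y w.
Proof. by case/andP. Qed.

Lemma up_edge u w : upward u w -> e u w.
Proof. by case/andP. Qed.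

Lemma lo_cases u v : [\/ lo u = lo v, lo u + K.+2 <= lo v | lo v + K.+2 <= lo u].
Proof.
case: (ltngtP (lo u) (lo v)) => h.
- by apply: Or32; exact: (lay_block L).
- by apply: Or33; exact: (lay_block L).
- exact: Or31.
Qed.

Lemma row_end_lt u w z : upward u w -> y w < y z -> row_end u w < y z /\ (lo w <> lo z -> row_end u w < lo z).
Proof.
move=> h wz; have [h1 h2] := row_endP h.
have := lay_lo L w; have := lay_lo L z => lz lw.
case: (lo_cases w z) => c; try lia.
have [E|N] := eqVneq (row_end u w) (y w); first by lia.
by have [_ h3] := h2 (elimN eqP N); have := h3 z (Logic.eq_sym c); lia.
Qed.

(** Edges sharing a column are never active in the same row, so the first ends no later than the
    second starts. The second dips below its start only through a bottom port, in a window that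
    active edges of the block avoid; if [w = u'], the contact is that vertex. *)
Lemma through_start u w u' w' r : upward u w -> upward u' w' -> (u, w) <> (u', w') ->
  C u w = C u' w' -> y u <= y u' ->
  row_start u w <= r <= row_end u w -> row_start u' w' <= r <= row_end u' w' ->
  joint u w u' w' (C u w) r.
Proof.
move=> h h' ne E yy hr hr'.
have [s1 s2] := row_startP h'; have [t1 t2] := row_endP h.
have uw := up_lt h; have uw' := up_lt h'.
have lu := lay_lo L u; have lu' := lay_lo L u'; have lw := lay_lo L w; have lw' := lay_lo L w'.
have [Eu|Nu] := eqVneq u u'.
  subst u'; case: ne.
  case: (leqP (y w) (y w')) => hw.
    by apply: (@lay_active L w) => //; rewrite /active ?h ?h' /=; lia.
  by apply: (@lay_active L w') => //; rewrite /active ?h ?h' /=; lia.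
have {}yy : y u < y u'.
  by rewrite ltn_neqAle yy andbT; apply: contraNneq Nu => /(lay_inj L) ->.
have wu : y w <= y u'.
  case: leqP => // hw; case: ne; case: (leqP (y w) (y w')) => hw'.
    by apply: (@lay_active L w) => //; rewrite /active ?h ?h' /=; lia.
  by apply: (@lay_active L w') => //; rewrite /active ?h ?h' /=; lia.
have act : active (y w) u w by rewrite /active h uw leqnn.
have [Ew|Nw] := eqVneq w u'.
  subst u'; have nW := lay_window L act erefl (leqnn _).
  have ho := lay_out L h'; have hi := lay_in L h.
  have hT : P w w' = PT.
    by move: ho; rewrite /out_spec -E; case: (P w w') => // -[_]; rewrite (negbTE nW).
  have cX : C u w = X w by move: ho; rewrite /out_spec hT E.
  have st : row_start w w' = y w by rewrite /row_start hT.
  exists w; first by rewrite !inE eqxx orbT.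
  split=> //; suff rE : row_end u w = y w by lia.
  rewrite /row_end; move: hi; rewrite /in_spec; case: (P w u) => //.
  by case=> /(_ cX).
have {}wu : y w < y u'.
  by rewrite ltn_neqAle wu andbT; apply: contraNneq Nw => /(lay_inj L) ->.
have [b1 b2] := row_end_lt h wu.
have [Es|Ns] := eqVneq (row_start u' w') (y u'); first by lia.
have [_ s3 s4 _] := s2 (elimN eqP Ns).
have [El|Nl] := eqVneq (lo w) (lo u'); last by move/eqP: Nl => /b2; lia.
by have := lay_window L act El (ltnW wu); rewrite E s4.
Qed.

(** The stub under [u] lies in a window column. An edge starting below [u] that meets it would be
    active in this window within the block; one starting later in the block dips only inside a
    disjoint window; one starting at [u] touches just there. *)
Lemma bottom_through u w u' w' r : upward u w -> upward u' w' -> (u, w) <> (u', w') ->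
  P u w = PB -> C u' w' = X u -> lo u <= r <= y u ->
  row_start u' w' <= r <= row_end u' w' -> joint u w u' w' (X u) r.
Proof.
move=> h h' ne pB E hr hr'.
have := lay_out L h; rewrite /out_spec pB => -[cX Wc WX].
have [s1 s2] := row_startP h'; have [t1 t2] := row_endP h'.
have uw := up_lt h; have uw' := up_lt h'.
have lu := lay_lo L u; have lu' := lay_lo L u'; have lw := lay_lo L w; have lw' := lay_lo L w'.
case: (ltngtP (y u') (y u)) => c.
- case: (leqP (y u) (y w')) => d.
    have a : active (y u) u' w' by rewrite /active h' c d.
    by have := lay_window L a erefl (leqnn _); rewrite E WX.
  have [b1 b2] := row_end_lt h' d.
  have [El|Nl] := eqVneq (lo w') (lo u); last by move/eqP: Nl => /b2; lia.
  have a : active (y w') u' w' by rewrite /active h' uw' leqnn.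
  by have := lay_window L a El (ltnW d); rewrite E WX.
- have [Es|Ns] := eqVneq (row_start u' w') (y u'); first by lia.
  have [_ s3 s4 _] := s2 (elimN eqP Ns).
  case: (lo_cases u u') => l; try lia.
  by have := lay_sep L l c WX s4; rewrite E ltnn.
- have Eu := lay_inj L c; subst u'; exists u; first by rewrite !inE eqxx.
  split=> //; suff : row_start u w' = y u by lia.
  rewrite /row_start; have := lay_out L h'; rewrite /out_spec.
  by case: (P u w') => //; case=> /(_ E).
Qed.

(** In row [y w] the column of [w] belongs to the edge at its bottom port alone, and that edge ends
    in [w]. Other edges end below [w] or start in a later block, beyond the spare row. *)
Lemma top_through u w u' w' r : upward u w -> upward u' w' -> (u, w) <> (u', w') ->
  P w u = PT -> C u' w' = X w -> y w <= r <= (y w).+1 ->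
  row_start u' w' <= r <= row_end u' w' -> joint u w u' w' (X w) r.
Proof.
move=> h h' ne pT E hr hr'.
have := lay_in L h; rewrite /in_spec pT => -[cX last noout [u2 h2 pB]].
have [s1 s2] := row_startP h'; have [t1 t2] := row_endP h'.
have uw := up_lt h; have uw' := up_lt h'; have uw2 := up_lt h2.
have lu := lay_lo L u; have lu' := lay_lo L u'; have lw := lay_lo L w; have lw' := lay_lo L w'.
have c2 : C u2 w = X w by have := lay_in L h2; rewrite /in_spec pB.
case: (ltngtP (y u') (y w)) => c.
- case: (leqP (y w) (y w')) => d.
    have [Ew Eu] : u2 = u' /\ w = w'.
      have a : active (y w) u' w' by rewrite /active h' c d.
      have a2 : active (y w) u2 w by rewrite /active h2 uw2 leqnn.
      by have := lay_active L a2 a; rewrite c2 E => /(_ erefl) [].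
    subst u' w'; exists w; first by rewrite !inE eqxx !orbT.
    by split=> //; move: hr'; rewrite /row_end pB; lia.
  by have [b1 b2] := row_end_lt h' d; lia.
- case: (lo_cases u' w) => l; try lia.
  by have := last _ l; lia.
- by have Eu := lay_inj L c; subst u'; have := noout w'; rewrite h'.
Qed.

Lemma out_bottom u w : upward u w -> P u w = PB ->
  [/\ C u w <> X u, Win u (C u w) & Win u (X u)].
Proof. by move=> h p; have := lay_out L h; rewrite /out_spec p. Qed.

Lemma in_top u w : upward u w -> P w u = PT ->
  [/\ C u w <> X w, (forall z, lo z = lo w -> y z <= y w) & (forall z, ~~ upward w z)].
Proof. by move=> h p; have := lay_in L h; rewrite /in_spec p => -[]. Qed.

Lemma vcovers_meet u w u' w' x r : upward u w -> upward u' w' -> (u, w) <> (u', w') ->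
  vcovers u w x r -> vcovers u' w' x r -> joint u w u' w' x r.
Proof.
move=> h h' ne.
have ne' : (u', w') <> (u, w) by move=> E; apply: ne; rewrite E.
have bottop a b a' b' : upward a b -> upward a' b' -> P a b = PB -> P b' a' = PT ->
    X a = X b' -> lo a <= r <= y a -> y b' <= r <= (y b').+1 -> False.
  move=> g g' pB pT E r1 r2; have [_ last no] := in_top g' pT.
  have la := lay_lo L a; have lb := lay_lo L b'.
  case: (lo_cases a b') => l; try lia.
  case: (ltngtP (y a) (y b')) => c; first by lia.
    by have := last _ l; lia.
  by have := no b; rewrite -(lay_inj L c) g.
have lu := lay_lo L u; have lu' := lay_lo L u'; have lw := lay_lo L w; have lw' := lay_lo L w'.
case=> [[p1 x1 r1]|[x1 r1]|[p1 x1 r1]] [[p2 x2 r2]|[x2 r2]|[p2 x2 r2]]; subst x.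
- have [_ _ W1] := out_bottom h p1; have [_ _ W2] := out_bottom h' p2.
  case: (lo_cases u u') => l; try lia.
  rewrite -x2 in W2; have E := win_inj l W1 W2; subst u'; case: ne; congr pair.
  by apply: (@lay_port L u); rewrite ?(up_edge h) ?(up_edge h') ?p1 ?p2.
- exact: bottom_through.
- by case: (bottop u w u' w').
- by rewrite x2; apply: jointC; apply: bottom_through => //; rewrite -x2.
- have [c|c] := leqP (y u) (y u'); first exact: through_start.
  by rewrite x2; apply: jointC; apply: through_start => //; exact: ltnW.
- by rewrite x2; apply: jointC; apply: top_through => //; rewrite -x2.
- by case: (bottop u' w' u w).
- exact: top_through.
- have [_ last _] := in_top h p1; have [_ last' _] := in_top h' p2.
  case: (lo_cases w w') => l; try lia.
  have E : w = w'.
    by apply: (lay_inj L); apply/eqP; rewrite eqn_leq (last' _ l) (last _ (Logic.eq_sym l)).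
  subst w'; case: ne; congr pair.
  by apply: (@lay_port L w); rewrite 1?esym ?(up_edge h) ?(up_edge h') ?p1 ?p2.
Qed.

Definition side (p : port) : bool := (p == PL) || (p == PR).

Definition within (a b x : nat) : bool := minn a b <= x <= maxn a b.

Definition hcovers (u w : T) (x r : nat) : Prop :=
  [\/ exists v o, [/\ (v, o) \in [:: (u, w); (w, u)], side (P v o), r = y v &
                     within (X v) (C u w) x],
      [/\ P u w = PB, r = lo u & within (X u) (C u w) x] |
      [/\ P w u = PT, r = (y w).+1 & within (X w) (C u w) x]].

Lemma side_spec (u w v o : T) : upward u w -> (v, o) \in [:: (u, w); (w, u)] -> side (P v o) ->
  (P v o = PL /\ C u w < X v) \/ (P v o = PR /\ X v < C u w).
Proof.
move=> h; rewrite !inE => /orP[] /eqP[-> ->]; rewrite /side.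
  have := lay_out L h; rewrite /out_spec; case: (P u w) => //= -[]; auto.
have := lay_in L h; rewrite /in_spec; case: (P w u) => //=; auto.
Qed.

Lemma incident (u w v o : T) : (v, o) \in [:: (u, w); (w, u)] -> v \in [:: u; w].
Proof. by rewrite !inE => /orP[] /eqP[-> _]; rewrite eqxx ?orbT. Qed.

Lemma incident_edge (u w v o : T) : upward u w -> (v, o) \in [:: (u, w); (w, u)] -> e v o.
Proof. by move=> /up_edge h; rewrite !inE => /orP[] /eqP[-> ->] //; rewrite esym. Qed.

Lemma incident_up (u w u' w' v o : T) : upward u w -> upward u' w' ->
  (v, o) \in [:: (u, w); (w, u)] -> (v, o) \in [:: (u', w'); (w', u')] -> (u, w) = (u', w').
Proof.
move=> /up_lt h /up_lt h'; rewrite !inE => /orP[] /eqP[-> ->] /orP[] /eqP[E1 E2]; subst => //.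
  by move: h h'; lia.
by move: h h'; lia.
Qed.

(** Vertex rows, shared rows and spare rows never coincide. In a vertex row the left and right ports
    keep edges apart, in a shared row the order of the windows does, and a spare row serves only the
    last vertex of its block. *)
Lemma hcovers_meet u w u' w' x r : upward u w -> upward u' w' -> (u, w) <> (u', w') ->
  hcovers u w x r -> hcovers u' w' x r -> joint u w u' w' x r.
Proof.
move=> h h' ne.
have lov a b : lo a = y b -> False.
  by move=> E; have := lay_lo L a; have := lay_lo L b; case: (lo_cases a b) => l; lia.
have tov a b v : upward a b -> P b a = PT -> y v = (y b).+1 -> False.
  move=> g p E; have [_ last _] := in_top g p.
  have := lay_lo L b; have := lay_lo L v; case: (lo_cases b v) => l; try lia.
  by have := last v (Logic.eq_sym l); lia.
have tol a b v : upward a b -> P b a = PT -> lo v = (y b).+1 -> False.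
  move=> g p E; have := lay_lo L b; have := lay_lo L v; case: (lo_cases b v) => l; lia.
case=> [[v [o [i1 s1 r1 b1]]]|[p1 r1 b1]|[p1 r1 b1]]
       [[v' [o' [i2 s2 r2 b2]]]|[p2 r2 b2]|[p2 r2 b2]]; subst r.
- have E := lay_inj L r2; subst v'; exists v.
    by rewrite (incident i1) (incident i2).
  split=> //.
  have e1 := incident_edge h i1; have e2 := incident_edge h' i2.
  have same : P v o = P v o' -> False.
    move=> E; apply: ne; have E' := lay_port L e1 e2 E; subst o'.
    exact: incident_up h h' i1 i2.
  move: b1 b2; rewrite /within.
  have [[q1 c1]|[q1 c1]] := side_spec h i1 s1; have [[q2 c2]|[q2 c2]] := side_spec h' i2 s2;
    try (by case: same; rewrite q1 q2); lia.
- by case: (lov u' v).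
- by case: (tov u' w' v).
- by case: (lov u v').
- have [_ W1 W2] := out_bottom h p1; have [_ W1' W2'] := out_bottom h' p2.
  case: (ltngtP (y u) (y u')) => c.
  + have := lay_sep L r2 c W1 W1'; have := lay_sep L r2 c W1 W2'.
    have := lay_sep L r2 c W2 W1'; have := lay_sep L r2 c W2 W2'.
    by move: b1 b2; rewrite /within; lia.
  + have := lay_sep L (Logic.eq_sym r2) c W1' W1; have := lay_sep L (Logic.eq_sym r2) c W1' W2.
    have := lay_sep L (Logic.eq_sym r2) c W2' W1; have := lay_sep L (Logic.eq_sym r2) c W2' W2.
    by move: b1 b2; rewrite /within; lia.
  have E := lay_inj L c; subst u'; case: ne; congr pair.
  by apply: (@lay_port L u); rewrite ?(up_edge h) ?(up_edge h') ?p1 ?p2.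
- by case: (tol u' w' u).
- by case: (tov u w v').
- by case: (tol u w u').
- case: r2 => r2; have E := lay_inj L r2; subst w'; case: ne; congr pair.
  by apply: (@lay_port L w); rewrite 1?esym ?(up_edge h) ?(up_edge h') ?p1 ?p2.
Qed.

(** A vertex stands in its window or in the column of its bottom edge. Other edges active in its row
    avoid both, and so do the dips belonging to later vertices of the block. *)
Lemma vertex_on_vcovers u w z : upward u w -> vcovers u w (X z) (y z) -> z \in [:: u; w].
Proof.
move=> h; have uw := up_lt h.
have lu := lay_lo L u; have lw := lay_lo L w; have lz := lay_lo L z.
have [s1 s2] := row_startP h; have [t1 t2] := row_endP h.
have inw b a : upward u w -> Win b a -> lo b = lo z -> y z < y b -> a = X z -> False.
  move=> _ Wa l c E; case: (lay_col L z) => [Wz|[a' g p]].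
    by have := lay_sep L (Logic.eq_sym l) c Wz Wa; lia.
  have act : active (y z) a' z by rewrite /active g (up_lt g) leqnn.
  have := lay_window L act (Logic.eq_sym l) (ltnW c).
  by have := lay_in L g; rewrite /in_spec p => ->; rewrite -E Wa.
have ond : u != z -> w != z -> y u <> y z /\ y w <> y z.
  by move=> n1 n2; split=> E; [move: n1|move: n2]; rewrite (lay_inj L E) eqxx.
rewrite !inE !(eq_sym z); case: (eqVneq u z) => //= nu; case: (eqVneq w z) => //= nw.
have [yu yw] := ond nu nw.
case=> [[p E b]|[E b]|[p E b]].
- have [_ _ W2] := out_bottom h p; case: (lo_cases u z) => l; try lia.
  by case: (inw u (X u)) => //; lia.
- case: (ltngtP (y z) (y u)) => c1; last by case: yu.
    have [|_ s3 W2 _] := s2; first by lia.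
    case: (lo_cases u z) => l; try lia.
    by case: (inw u (C u w)).
  case: (leqP (y z) (y w)) => c2.
    have act : active (y z) u w by rewrite /active h c1 c2.
    case: (lay_col L z) => [Wz|[a g p]].
      by have := lay_window L act erefl (leqnn _); rewrite -E Wz.
    have act' : active (y z) a z by rewrite /active g (up_lt g) leqnn.
    have := lay_in L g; rewrite /in_spec p => Ca.
    have := lay_active L act' act; rewrite Ca E => /(_ erefl) [_ E2].
    by rewrite E2 eqxx in nw.
  by have [] := row_end_lt h c2; lia.
- have [_ last _] := in_top h p; case: (lo_cases w z) => l; try lia.
  by have := last z (Logic.eq_sym l); lia.
Qed.

Lemma vertex_on_hcovers u w z : upward u w -> hcovers u w (X z) (y z) -> z \in [:: u; w].
Proof.
move=> h; case=> [[v [o [i s E b]]]|[p E b]|[p E b]].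
- by rewrite (lay_inj L E); apply: incident i.
- by have := lay_lo L u; have := lay_lo L z; case: (lo_cases u z) => l; lia.
- have [_ last _] := in_top h p; have := lay_lo L w; have := lay_lo L z.
  case: (lo_cases w z) => l; try lia.
  by have := last z (Logic.eq_sym l); lia.
Qed.

End Layout.

(** * Integer points of segments and polylines *)

Definition origin : gpoint := (0, 0)%R.

Lemma segsP (p : seq gpoint) s : s \in segs p ->
  exists2 i, i.+1 < size p & s = (nth origin p i, nth origin p i.+1).
Proof.
move=> /(nthP (origin, origin))[i]; rewrite size_zip size_behead => hi <-.
exists i; first by rewrite -ltn_predRL; move: hi; rewrite leq_min => /andP[].
by rewrite /segs nth_zip_cond size_zip size_behead hi nth_behead.
Qed.

Lemma mem_segs (p : seq gpoint) i : i.+1 < size p ->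
  (nth origin p i, nth origin p i.+1) \in segs p.
Proof.
move=> hi; have hs : i < size (segs p).
  by rewrite size_zip size_behead leq_min ltn_predRL hi ltnW.
suff <- : nth (origin, origin) (segs p) i = (nth origin p i, nth origin p i.+1).
  exact: mem_nth.
by rewrite nth_zip_cond -/(segs p) hs nth_behead.
Qed.

Lemma segs_rev (p : seq gpoint) s : s \in segs (rev p) -> (s.2, s.1) \in segs p.
Proof.
case/segsP=> i; rewrite size_rev => hi -> /=.
rewrite !nth_rev; try lia.
have -> : size p - i.+1 = (size p - i.+2).+1 by lia.
by apply: mem_segs; lia.
Qed.

Lemma withinC a b x : within a b x = within b a x.
Proof. by rewrite /within minnC maxnC. Qed.

Section Meet.
Variable R : realType.

Lemma between_eq (a : int) (q : R) : between a a q -> q = a%:~R%R.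
Proof. by rewrite /between => -[] /andP[? ?]; lra. Qed.

Lemma between_within (a b c : nat) : between (Posz a) (Posz b) (c%:Z%:~R%R : R) -> within a b c.
Proof. by rewrite /between !ler_int /within => -[]; lia. Qed.

(** Carries statements on integer points over to real ones: a real point common to two integer
    intervals lies between two integers common to both. *)
Lemma between_meet_nat (a b c d : nat) (q : R) : between a%:Z b%:Z q -> between c%:Z d%:Z q ->
  exists l h : nat, [/\ within a b l, within c d l, within a b h, within c d h
                     & (l%:Z%:~R <= q <= h%:Z%:~R)%R].
Proof.
move=> h1 h2; have := between_meet h1 h2 => hm.
have sort (m n : nat) : between m%:Z n%:Z q -> ((minn m n)%:Z%:~R <= q <= (maxn m n)%:Z%:~R)%R.
  rewrite /between /minn /maxn; case: ltnP => mn.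
    have : (m%:Z%:~R <= n%:Z%:~R :> R)%R by rewrite ler_int; lia.
    by move=> ? [] /andP[? ?]; apply/andP; split; lra.
  have : (n%:Z%:~R <= m%:Z%:~R :> R)%R by rewrite ler_int; lia.
  by move=> ? [] /andP[? ?]; apply/andP; split; lra.
exists (maxn (minn a b) (minn c d)), (minn (maxn a b) (maxn c d)).
have /andP[s1 s2] := sort _ _ h1; have /andP[s3 s4] := sort _ _ h2.
split; try by move: hm; rewrite /within; lia.
apply/andP; split; [rewrite /maxn | rewrite /minn]; by case: ifP.
Qed.

End Meet.

(** * The polygonal lines of a layout *)

Section Drawing.
Variables (R : realType) (T : finType) (e : rel T) (K : nat).
Variables (y lo X : T -> nat) (C : T -> T -> nat) (P : T -> T -> port).
Variable Win : T -> pred nat.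
Hypotheses (e_sym : symmetric e) (e_irr : irreflexive e).
Hypothesis L : layout e K y lo X C P Win.

Let up := upward e y.

Definition grid (z : nat * nat) : gpoint := (Posz z.1, Posz z.2).

Definition site (v : T) : nat * nat := (X v, y v).

Definition first_bends (u w : T) : seq (nat * nat) :=
  match P u w with
  | PT => [::]
  | PB => [:: (X u, lo u); (C u w, lo u)]
  | _ => [:: (C u w, y u)]
  end.

Definition last_bends (u w : T) : seq (nat * nat) :=
  match P w u with
  | PB => [::]
  | PT => [:: (C u w, (y w).+1); (X w, (y w).+1)]
  | _ => [:: (C u w, y w)]
  end.

Definition bends (u w : T) : seq (nat * nat) := first_bends u w ++ last_bends u w.

Definition pos (v : T) : gpoint := grid (site v).

(** Only the upward direction is constructed; the other one is its reversal, as a drawing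
    requires. *)
Definition route (u w : T) : seq gpoint :=
  if y u < y w then map grid (bends u w) else rev (map grid (bends w u)).

Lemma route_up u w : up u w -> route u w = map grid (bends u w).
Proof. by case/andP=> _; rewrite /route => ->. Qed.

Lemma route_sym u w : e u w -> route w u = rev (route u w).
Proof.
move=> euw; rewrite /route; case: ltngtP => // [_|E]; first by rewrite revK.
by move: euw; rewrite (lay_inj L E) e_irr.
Qed.

Lemma up_total u w : e u w -> up u w \/ up w u.
Proof.
move=> h; rewrite /up /upward h e_sym h /=; case: (ltngtP (y u) (y w)); auto.
by move=> E; move: h; rewrite (lay_inj L E) e_irr.
Qed.

Lemma polyline_up u w : up u w ->
  polyline pos route u w = map grid (site u :: rcons (bends u w) (site w)).
Proof. by move=> h; rewrite /polyline route_up //= map_rcons. Qed.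

Lemma polyline_rev u w : e u w -> polyline pos route w u = rev (polyline pos route u w).
Proof. by move=> h; rewrite /polyline route_sym // rev_cons rev_rcons. Qed.

Definition seg_covered (u w : T) (s : gpoint * gpoint) : Prop :=
  (exists x r1 r2, s = (grid (x, r1), grid (x, r2)) /\
     forall r, within r1 r2 r -> vcovers y lo X C P u w x r) \/
  (exists r x1 x2, s = (grid (x1, r), grid (x2, r)) /\
     forall x, within x1 x2 x -> hcovers y lo X C P u w x r).

Lemma top_col u w : up u w -> P u w = PT -> C u w = X u.
Proof. by move=> h p; have := lay_out L h; rewrite /out_spec p. Qed.

Lemma bottom_col u w : up u w -> P w u = PB -> C u w = X w.
Proof. by move=> h p; have := lay_in L h; rewrite /in_spec p. Qed.

Lemma seg_covered_up u w s : up u w -> s \in segs (polyline pos route u w) ->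
  seg_covered u w s.
Proof.
move=> h; rewrite polyline_up // /bends /first_bends /last_bends /site /segs.
have hu := top_col h; have hw := bottom_col h.
have [h1 _] := row_startP L h; have [h2 _] := row_endP L h; have h3 := up_lt h.
have h4 := lay_lo L u.
case E1: (P u w) hu => hu; case E2: (P w u) hw => hw /=;
  rewrite -?(hu erefl) -?(hw erefl) !inE => hs;
  repeat (case/orP: hs => hs); move/eqP: hs => ->;
  first [ left; do 3 eexists; split; [reflexivity|move=> r; rewrite /within => hr];
          first [ by apply: Or31; split=> //; lia
                | by apply: Or33; split=> //; rewrite ?(hw erefl) //; lia
                | by apply: Or32; split=> //; rewrite /row_start /row_end ?E1 ?E2; lia ]
        | right; do 3 eexists; split; [reflexivity|move=> r hr];
          first [ by apply: Or32
                | by apply: Or33; split=> //; rewrite withinC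
                | by apply: Or31; exists u, w; rewrite !inE eqxx E1
                | by apply: Or31; exists w, u; rewrite !inE eqxx orbT E2; split=> //; rewrite withinC ] ].
Qed.

(** Links an ordered pair of adjacent vertices to the upward orientation of its edge, so that both
    directions reduce to one. *)
Definition directed (a b u w : T) : Prop :=
  up u w /\ ((a, b) = (u, w) \/ (a, b) = (w, u)).

Lemma directed_exists a b : e a b -> exists u w, directed a b u w.
Proof.
by move=> h; have [g|g] := up_total h; [exists a, b|exists b, a]; split; auto.
Qed.

Lemma directed_segs a b u w s : directed a b u w ->
  s \in segs (polyline pos route a b) -> seg_covered u w s.
Proof.
case=> h [] [-> ->]; first exact: seg_covered_up.
rewrite (polyline_rev (up_edge h)) => /segs_rev /(seg_covered_up h).
case: s => s1 s2 /= [[x [r1 [r2 [[-> ->] hv]]]]|[r [x1 [x2 [[-> ->] hh]]]]].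
- by left; exists x, r2, r1; split=> // r; rewrite withinC; exact: hv.
- by right; exists r, x2, x1; split=> // x; rewrite withinC; exact: hh.
Qed.

Lemma directed_bends a b u w z : directed a b u w -> z \in route a b ->
  exists2 z', z' \in bends u w & z = grid z'.
Proof.
case=> h [] [-> ->]; last rewrite (route_sym (up_edge h)) mem_rev.
all: by rewrite route_up // => /mapP.
Qed.

(** A bend lies on a vertical and on a horizontal piece. Any segment of another edge through it is
    parallel to one of them, so the contact would be a common end vertex, and a bend never is
    one. *)
Lemma bends_covered u w z : up u w -> z \in bends u w ->
  [/\ vcovers y lo X C P u w z.1 z.2, hcovers y lo X C P u w z.1 z.2 &
      forall v, v \in [:: u; w] -> z <> site v].
Proof.
move=> h; have uw := up_lt h; have lu := lay_lo L u.
have [h1 _] := row_startP L h; have [h2 _] := row_endP L h.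
have w1 a b : within a b a by rewrite /within; lia.
have w2 a b : within a b b by rewrite /within; lia.
have := lay_out L h; have := lay_in L h; rewrite /in_spec /out_spec.
rewrite /bends /first_bends /last_bends /site mem_cat => hi ho /orP[].
  case E: (P u w) ho => // ho; rewrite !inE.
  1,2: move/eqP=> -> /=; split;
    [ by apply: Or32; rewrite /row_start E; split=> //; rewrite /row_start E in h1 *; lia
    | by apply: Or31; exists u, w; rewrite !inE eqxx E
    | by move=> v; rewrite !inE => /orP[] /eqP-> []; lia ].
  case: ho => hX _ _; case/orP=> /eqP-> /=; split.
  - by apply: Or31; split=> //; lia.
  - by apply: Or32.
  - by move=> v; rewrite !inE => /orP[] /eqP-> []; lia.
  - by apply: Or32; rewrite /row_start E; split=> //; lia.
  - by apply: Or32.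
  - by move=> v; rewrite !inE => /orP[] /eqP-> []; lia.
case E: (P w u) hi => // hi; rewrite !inE.
1,2: move/eqP=> -> /=; split;
  [ by apply: Or32; rewrite /row_end E; split=> //; lia
  | by apply: Or31; exists w, u; rewrite !inE eqxx orbT E
  | by move=> v; rewrite !inE => /orP[] /eqP-> []; lia ].
case: hi => hX _ _ _; case/orP=> /eqP-> /=; split.
- by apply: Or32; rewrite /row_end E; split=> //; lia.
- by apply: Or33.
- by move=> v; rewrite !inE => /orP[] /eqP-> []; lia.
- by apply: Or33; split=> //; lia.
- by apply: Or33.
- by move=> v; rewrite !inE => /orP[] /eqP-> []; lia.
Qed.

Lemma directed_distinct a b u w a' b' u' w' : directed a b u w -> directed a' b' u' w' ->
  ~~ same_edge a b a' b' -> (u, w) <> (u', w').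
Proof.
by move=> [_ d] [_ d'] n [E1 E2]; subst; move: n; rewrite /same_edge;
  case: d d' => [] [-> ->] [] [-> ->]; rewrite !eqxx ?orbT.
Qed.

(** Distinct edges share at most one end vertex, since the rows determine which end is the lower
    one. *)
Lemma joint_eq u w u' w' x r x' r' : up u w -> up u' w' -> (u, w) <> (u', w') ->
  joint y X u w u' w' x r -> joint y X u w u' w' x' r' -> (x, r) = (x', r').
Proof.
move=> h h' ne [v [i1 i2] [-> ->]] [v' [i1' i2'] [-> ->]].
suff -> : v = v' by [].
have := up_lt h; have := up_lt h'.
move: i1 i2 i1' i2'; rewrite !inE.
by do 4 (case/orP=> /eqP ?); subst => //; try (by case: ne); move=> *; lia.
Qed.

Definition point (z : nat * nat) : R * R := rpt R (grid z).

(** Perpendicular segments meet at most once. For parallel ones the common real points are enclosed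
    by common integer points, all of which are the single shared vertex. *)
Lemma segs_meet u w u' w' s s' q1 q2 : up u w -> up u' w' -> (u, w) <> (u', w') ->
  seg_covered u w s -> seg_covered u' w' s' ->
  on_seg s q1 -> on_seg s' q1 -> on_seg s q2 -> on_seg s' q2 -> q1 = q2 :> R * R.
Proof.
move=> h h' ne.
have real_eq (q : R) (a : nat) : (a%:Z%:~R <= q <= a%:Z%:~R)%R -> q = (a%:Z%:~R)%R.
  by move=> /andP[? ?]; lra.
have pe (q q' : R * R) : q.1 = q'.1 -> q.2 = q'.2 -> q = q'.
  by case: q q' => a b [c d] /= -> ->.
have inter (q : R) a : between a a q -> q = (a%:~R)%R by exact: between_eq.
have intr_nat (a b : nat) : (a%:Z%:~R = b%:Z%:~R :> R)%R -> a = b by move/intr_inj; case.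
case=> [[x [r1 [r2 [-> c]]]]|[r [x1 [x2 [-> c]]]]]
       [[x' [r1' [r2' [-> c']]]]|[r' [x1' [x2' [-> c']]]]] //=;
move=> /on_seg_between[/= a1 b1] /on_seg_between[/= a1' b1'];
move=> /on_seg_between[/= a2 b2] /on_seg_between[/= a2' b2'].
- have Ex : x = x' by apply: intr_nat; rewrite -(inter _ _ a1) -(inter _ _ a1').
  subst x'; have [l [t [w1 w2 w3 w4 b]]] := between_meet_nat b1 b1'.
  have [l' [t' [w1' w2' w3' w4' b']]] := between_meet_nat b2 b2'.
  have J r : within r1 r2 r -> within r1' r2' r -> joint y X u w u' w' x r.
    by move=> ? ?; apply: (vcovers_meet e_sym L) => //; [exact: c|exact: c'].
  have U r r' := @joint_eq u w u' w' x r x r' h h' ne.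
  have [E1] := U _ _ (J _ w1 w2) (J _ w3 w4).
  have [E2] := U _ _ (J _ w1 w2) (J _ w1' w2').
  have [E3] := U _ _ (J _ w1 w2) (J _ w3' w4').
  subst l' t' t; apply: pe.
    by rewrite (inter _ _ a1) (inter _ _ a2).
  by rewrite (real_eq _ _ b) (real_eq _ _ b').
- apply: pe.
    by rewrite (inter _ _ a1) (inter _ _ a2).
  by rewrite (inter _ _ b1') (inter _ _ b2').
- apply: pe.
    by rewrite (inter _ _ a1') (inter _ _ a2').
  by rewrite (inter _ _ b1) (inter _ _ b2).
- have Er : r = r' by apply: intr_nat; rewrite -(inter _ _ b1) -(inter _ _ b1').
  subst r'; have [l [t [w1 w2 w3 w4 b]]] := between_meet_nat a1 a1'.
  have [l' [t' [w1' w2' w3' w4' b']]] := between_meet_nat a2 a2'.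
  have J x : within x1 x2 x -> within x1' x2' x -> joint y X u w u' w' x r.
    by move=> ? ?; apply: (hcovers_meet e_sym L) => //; [exact: c|exact: c'].
  have U x x' := @joint_eq u w u' w' x r x' r h h' ne.
  have [E1] := U _ _ (J _ w1 w2) (J _ w3 w4).
  have [E2] := U _ _ (J _ w1 w2) (J _ w1' w2').
  have [E3] := U _ _ (J _ w1 w2) (J _ w3' w4').
  subst l' t' t; apply: pe.
    by rewrite (real_eq _ _ b) (real_eq _ _ b').
  by rewrite (inter _ _ b1) (inter _ _ b2).
Qed.

Lemma covered_point u w s z : seg_covered u w s -> on_seg s (point z) ->
  vcovers y lo X C P u w z.1 z.2 \/ hcovers y lo X C P u w z.1 z.2.
Proof.
case: z => zx zy; rewrite /point /rpt /grid /=.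
by case=> [[x [r1 [r2 [-> c]]]]|[r [x1 [x2 [-> c]]]]] /on_seg_between[/= a b];
  [left|right];
  [ have /intr_inj[->] := between_eq a; apply: c; exact: between_within b
  | have /intr_inj[->] := between_eq b; apply: c; exact: between_within a ].
Qed.

Lemma bends_avoid u w u' w' s z : up u w -> up u' w' -> (u, w) <> (u', w') ->
  z \in bends u w -> seg_covered u' w' s -> on_seg s (point z) -> False.
Proof.
move=> h h' ne hz hs /(covered_point hs) hc.
have [v1 v2 v3] := bends_covered h hz.
have [v [i _] [E1 E2]] : joint y X u w u' w' z.1 z.2.
  by case: hc => hc; [apply: (vcovers_meet e_sym L)|apply: (hcovers_meet e_sym L)].
by apply: (v3 v i); case: z E1 E2 {hz hs hc v1 v2 v3} => a b /= -> ->.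
Qed.

End Drawing.

Lemma axis_vertical x a b : axis_seg (grid (x, a), grid (x, b)) = (a != b).
Proof. by rewrite /axis_seg /grid /= eqxx eqz_nat; case: (a == b). Qed.

Lemma axis_horizontal x a b : axis_seg (grid (a, x), grid (b, x)) = (a != b).
Proof. by rewrite /axis_seg /grid /= eqxx eqz_nat; case: (a == b). Qed.

Section Drawing.
Variables (R : realType) (T : finType) (e : rel T) (K : nat).
Variables (y lo X : T -> nat) (C : T -> T -> nat) (P : T -> T -> port).
Variable Win : T -> pred nat.
Hypotheses (e_sym : symmetric e) (e_irr : irreflexive e).
Hypothesis L : layout e K y lo X C P Win.

Let up := upward e y.
Let pos := pos y X.
Let route := route y lo X C P.

Lemma polyline_orth u w : up u w ->
  orth_polyline R (polyline pos route u w) /\ orth_polyline R (polyline pos route w u).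
Proof.
move=> h; rewrite /route (polyline_rev e_irr L (up_edge h)) (polyline_up lo X C P h).
rewrite /bends /first_bends /last_bends /site.
have hu := top_col L h; have hw := bottom_col L h; have uw := up_lt h.
have lu := lay_lo L u.
have := lay_out L h; have := lay_in L h; rewrite /in_spec /out_spec.
case E1: (P u w) hu => hu; case E2: (P w u) hw => hw /=;
  rewrite -?(hu erefl) -?(hw erefl) => hin hout;
  (* [X1] and [X2] exclude degenerate segments: the column of the edge differs from that of an end
     vertex unless the edge leaves straight up or arrives straight from below. *)
  (have X1 : (C u w != X u) || (if P u w is PT then true else false)
     by rewrite ?E1 /= ?orbT; first [by [] | by case: hout; lia]);
  (have X2 : (C u w != X w) || (if P w u is PB then true else false)
     by rewrite ?E2 /= ?orbT; first [by [] | by lia | by case: hin; lia]);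
  rewrite ?E1 ?E2 /= in X1 X2; clear hin hout; split; apply: orth_polyline_intro; rewrite /rev /=.
all: try by case=> [|[|[|[|?]]]] //= _; rewrite /horizontal /=; lia.
all: clear hu hw; try by rewrite ?axis_vertical ?axis_horizontal; lia.
all: by case=> [|[|[|[|?]]]] [|[|[|[|[|?]]]]] //=; rewrite ?andbF // => _; rewrite /apart /grid /=; lia.
Qed.

Lemma layout_drawing : orth_drawing R e pos route.
Proof.
split; [|split; [|split; [|split]]].
- by move=> v v' [_ E]; apply: (lay_inj L E).
- by move=> a b h; apply: (route_sym e_irr L).
- move=> a b h; have [g|g] := up_total e_sym e_irr L h.
    by have [] := polyline_orth g.
  by have [] := polyline_orth g.
- move=> a b z h za zb [s hs hq].
  have [u [w d]] := directed_exists e_sym e_irr L h.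
  have c := directed_segs e_irr L d hs; case: d => g d.
  have : z \in [:: u; w].
    have [hv|hv] := covered_point (z := site y X z) c hq.
      exact: (vertex_on_vcovers L g hv).
    exact: (vertex_on_hcovers L g hv).
  by rewrite !inE; case: d za zb => [] [-> ->] /negbTE-> /negbTE->.
- move=> a b a' b' h h' n.
  have [u [w d]] := directed_exists e_sym e_irr L h.
  have [u' [w' d']] := directed_exists e_sym e_irr L h'.
  have ne := directed_distinct d d' n.
  have ne' : (u', w') <> (u, w) by move=> E; apply: ne; rewrite E.
  have g := d.1; have g' := d'.1.
  split=> [s s' hs hs' q1 q2|q [s hs hq] [s' hs' hq']].
    exact: (segs_meet e_sym L g g' ne (directed_segs e_irr L d hs) (directed_segs e_irr L d' hs')).
  split; apply/negP => /mapP[z hz E]; subst q.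
    have [z' hz' E] := directed_bends e_irr L d hz; subst z.
    exact: (bends_avoid e_sym L g g' ne hz' (directed_segs e_irr L d' hs') hq').
  have [z' hz' E] := directed_bends e_irr L d' hz; subst z.
  exact: (bends_avoid e_sym L g' g ne' hz' (directed_segs e_irr L d hs) hq).
Qed.

End Drawing.

(** * Counting the grid lines *)

Lemma foldr_min_max (s : seq int) (M : nat) : 0 < M ->
  (forall z, z \in s -> (0 <= z < M%:Z)%R) ->
  (0 <= minl s < M%:Z)%R /\ (0 <= maxl s < M%:Z)%R.
Proof.
move=> M0 hs.
have h0 : (0 <= head 0 s < M%:Z)%R.
  by case: s hs => [|a s] hs /=; [lia|apply: hs; rewrite inE eqxx].
rewrite /minl /maxl; move: (head 0%R s) h0 => a ha.
elim: s hs => //= b s IH hs.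
have [|h1 h2] := IH; first by move=> z hz; apply: hs; rewrite inE hz orbT.
by have := hs b (mem_head _ _); rewrite /Num.min /Num.max; case: ifP; case: ifP.
Qed.

Lemma count_int_range (s : seq int) (M : nat) p : 0 < M ->
  (forall z, z \in s -> (0 <= z < M%:Z)%R) ->
  count p (int_range (minl s) (maxl s)) <= M.
Proof.
move=> M0 hs; apply: leq_trans (count_size _ _) _.
have [h1 h2] := foldr_min_max M0 hs.
by rewrite size_map size_iota; lia.
Qed.

Section Area.
Variables (T : finType) (e : rel T) (K : nat).
Variables (y lo X : T -> nat) (C : T -> T -> nat) (P : T -> T -> port).
Variable Win : T -> pred nat.
Hypotheses (e_sym : symmetric e) (e_irr : irreflexive e).
Hypothesis L : layout e K y lo X C P Win.
Variables H W : nat.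
Hypotheses (H0 : 0 < H) (W0 : 0 < W).
Hypothesis y_lt : forall v, (y v).+1 < H.
Hypothesis X_lt : forall v, X v < W.
Hypothesis C_lt : forall u w, upward e y u w -> C u w < W.

Let pos := pos y X.
Let route := route y lo X C P.

(** Bends at a top port lie one row above the vertex, which explains the successor in [y_lt]. *)
Lemma point_bounds z : z \in all_points e pos route ->
  exists a b, [/\ z = grid (a, b), a < W & b < H].
Proof.
rewrite mem_cat => /orP[/mapP[v _ ->]|/flattenP[s]].
  by exists (X v), (y v); split=> //; apply: ltnW.
case/allpairsPdep=> a [b [_]]; rewrite mem_filter => /andP[h _] -> hz.
have [u [w d]] := directed_exists e_sym e_irr L h.
have [z' hz' ->] := directed_bends e_irr L d hz.
have g := d.1; have yu := y_lt u; have yw := y_lt w; have lu := lay_lo L u.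
have := X_lt u; have := X_lt w; have := C_lt g => c xw xu.
move: hz'; rewrite mem_cat /first_bends /last_bends => /orP[].
  by case: (P u w); rewrite ?inE // => hb; repeat (case/orP: hb => hb); move/eqP: hb => -> /=;
    do 2 eexists; split; try reflexivity; lia.
by case: (P w u); rewrite ?inE // => hb; repeat (case/orP: hb => hb); move/eqP: hb => -> /=;
  do 2 eexists; split; try reflexivity; lia.
Qed.

Lemma layout_area : drawing_area e pos route <= H * W.
Proof.
apply: leq_mul.
  apply: count_int_range => // z /mapP[a /point_bounds[b [c [-> _ hc]]] ->].
  by rewrite /grid /=; lia.
apply: count_int_range => // z /mapP[a /point_bounds[b [c [-> hb _]]] ->].
by rewrite /grid /=; lia.
Qed.

End Area.

(** * Existence of a layout *)

Definition in_ok (cs : seq nat) (X : nat) (pin : seq port) (i : nat) : Prop :=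
  match nth PL pin i with
  | PL => nth 0 cs i < X
  | PR => X < nth 0 cs i
  | PB => nth 0 cs i = X
  | PT => [/\ nth 0 cs i <> X, size cs = 4 & PB \in pin]
  end.

Definition out_ok (F : seq nat) (X : nat) (pout : seq port) (co : seq nat) (i : nat) : Prop :=
  match nth PL pout i with
  | PL => nth 0 co i < X /\ nth 0 co i \in F
  | PR => X < nth 0 co i /\ nth 0 co i \in F
  | PT => nth 0 co i = X
  | PB => [/\ nth 0 co i <> X, nth 0 co i \in F & X \in F]
  end.

(** The conditions on one vertex in list form: [F] is its window, [cs] lists the columns of its
    incoming edges, and [co] those chosen for its [o] outgoing edges. *)
Record ports (F cs : seq nat) (o : nat) (X : nat) (pin pout : seq port) (co : seq nat) : Prop := Ports {
  ports_sizes : [/\ size pin = size cs, size pout = o & size co = o];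
  ports_uniq : uniq (pin ++ pout);
  ports_cols : uniq co;
  ports_in : forall i, i < size cs -> in_ok cs X pin i;
  ports_out : forall i, i < o -> out_ok F X pout co i;
  ports_X : X \in F \/ exists2 i, i < size cs & nth PL pin i = PB
}.

Ltac solve_ports :=
  match goal with
  | |- and3 _ _ _ => by []
  | |- is_true (uniq (_ ++ _)) => by []
  | |- is_true (uniq _) => rewrite /= ?inE; first [by [] | lia]
  | |- _ \/ _ => rewrite ?inE ?eqxx ?orbT; first [by left | by right; exists 0 | by right; exists 1]
  | |- forall i, _ -> in_ok _ _ _ i =>
      case=> [|[|[|[|?]]]] //= _; rewrite /in_ok /= ?inE ?eqxx ?orbT; try split; first [by [] | lia]
  | |- forall i, _ -> out_ok _ _ _ _ i =>
      case=> [|[|[|[|?]]]] //= _; rewrite /out_ok /= ?inE ?eqxx ?orbT; try split; first [by [] | lia]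
  end.

(** With three or four incoming columns the vertex takes the second one. With at most one, or if
    [f1] separates two of them, it takes [f1]; otherwise it takes the one of the two nearer to [f1].
    A vertex without incoming edges uses all four columns of the window. *)
Lemma ports_full (f0 f1 f2 f3 : nat) (cs : seq nat) :
  f0 < f1 < f2 -> f2 < f3 -> sorted ltn cs -> size cs <= 4 ->
  all (fun a => a \notin [:: f0; f1; f2; f3]) cs ->
  exists X pin pout co, ports [:: f0; f1; f2; f3] cs (4 - size cs) X pin pout co.
Proof.
move=> f01 f23.
have build X pin pout co : [/\ size pin = size cs, size pout = 4 - size cs & size co = 4 - size cs] ->
  uniq (pin ++ pout) -> uniq co ->
  (forall i, i < size cs -> in_ok cs X pin i) ->
  (forall i, i < 4 - size cs -> out_ok [:: f0; f1; f2; f3] X pout co i) ->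
  (X \in [:: f0; f1; f2; f3] \/ exists2 i, i < size cs & nth PL pin i = PB) ->
  exists X pin pout co, ports [:: f0; f1; f2; f3] cs (4 - size cs) X pin pout co.
  by move=> *; exists X, pin, pout, co; split.
move: build; case: cs => [|p [|q [|r [|s [|? ?]]]]] //= build hs _;
  rewrite ?inE ?andbT => nF.
- apply: (build f1 [::] [:: PT; PL; PR; PB] [:: f1; f0; f2; f3]); clear build; solve_ports.
- have [c|c] := ltnP p f1.
    apply: (build f1 [:: PL] [:: PT; PR; PB] [:: f1; f2; f3]); clear build; solve_ports.
  apply: (build f1 [:: PR] [:: PT; PL; PB] [:: f1; f0; f3]); clear build; solve_ports.
- have [c|c] := ltnP q f1.
    apply: (build q [:: PL; PB] [:: PT; PR] [:: q; f1]); clear build; solve_ports.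
  have [d|d] := ltnP p f1.
    apply: (build f1 [:: PL; PR] [:: PT; PB] [:: f1; f3]); clear build; solve_ports.
  apply: (build p [:: PB; PR] [:: PT; PL] [:: p; f1]); clear build; solve_ports.
- apply: (build q [:: PL; PB; PR] [:: PT] [:: q]); clear build; solve_ports.
(* The third of four incoming edges is the one led over the top. *)
- apply: (build q [:: PL; PB; PT; PR] [::] [::]); clear build nF; solve_ports.
Qed.

(** A degree below four only drops outgoing edges from an assignment for degree four. *)
Lemma ports_exist (f0 f1 f2 f3 : nat) (cs : seq nat) (o : nat) :
  f0 < f1 < f2 -> f2 < f3 -> sorted ltn cs -> size cs + o <= 4 ->
  all (fun a => a \notin [:: f0; f1; f2; f3]) cs ->
  exists X pin pout co, ports [:: f0; f1; f2; f3] cs o X pin pout co.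
Proof.
move=> h1 h2 h3 h4 h5; have h6 : size cs <= 4 by lia.
have [X [pin [pout [co [[s1 s2 s3] u1 u2 pi po pX]]]]] := ports_full h1 h2 h3 h6 h5.
exists X, pin, (take o pout), (take o co); split=> //.
- by rewrite !size_take s2 s3; split=> //; case: ltnP; lia.
- by apply: subseq_uniq u1; rewrite cat_subseq // take_subseq.
- exact: take_uniq.
- by move=> i hi; rewrite /out_ok !nth_take //; apply: po; lia.
Qed.

(** * Sweeping the rows upwards *)

Section Exists.
Variables (T : finType) (e : rel T) (K W : nat) (y lo : T -> nat).
Hypotheses (e_sym : symmetric e) (e_irr : irreflexive e) (e_deg : max_degree_le e 4).
Hypothesis y_inj : injective y.
Hypothesis y_lo : forall v, lo v < y v <= lo v + K.
Hypothesis y_block : forall u v, lo u < lo v -> lo u + K.+2 <= lo v.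
Hypothesis full_last : forall v, #|[pred u | upward e y u v]| = 4 ->
  forall w, lo w = lo v -> y w <= y v.
Hypothesis cut_le : forall r,
  #|[pred p : T * T | active e y r p.1 p.2]| + 4 * K <= W.

Implicit Types (X : T -> nat) (C : T -> T -> nat) (P : T -> T -> port) (w : T -> nat -> nat).

Definition window w (v : T) : seq nat := [:: w v 0; w v 1; w v 2; w v 3].

Definition in_window w (v : T) : pred nat := fun a => a \in window w v.

Record vertex_ok X C P w (v : T) : Prop := VertexOk {
  ok_port : forall a b, e v a -> e v b -> P v a = P v b -> a = b;
  ok_in : forall u, upward e y u v -> in_spec e y lo X C P u v;
  ok_out : forall b, upward e y v b -> out_spec X C P (in_window w) v b /\ C v b < W;
  ok_col : in_window w v (X v) \/ exists2 u, upward e y u v & P v u = PB;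
  ok_lt : X v < W
}.

(** The invariant before row [r]: windows are fixed for blocks whose shared row lies below [r],
    columns for edges starting below [r]. The last two fields preserve what a layout demands in the
    vertex rows already passed. *)
Record state (r : nat) X C P w : Prop := State {
  st_lt : forall a b, active e y r a b -> C a b < W;
  st_inj : forall a b a' b', active e y r a b -> active e y r a' b' ->
    C a b = C a' b' -> (a, b) = (a', b');
  st_win : forall v, lo v < r -> [/\ w v 0 < w v 1 < w v 2, w v 2 < w v 3 & w v 3 < W];
  st_sep : forall u v, lo u = lo v -> lo u < r -> y u < y v -> w u 3 < w v 0;
  st_free : forall v a b, lo v < r <= y v -> active e y r a b -> ~~ in_window w v (C a b);
  st_ok : forall v, y v < r -> vertex_ok X C P w v;
  st_past_inj : forall z a b a' b', y z < r -> active e y (y z) a b ->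
    active e y (y z) a' b' -> C a b = C a' b' -> (a, b) = (a', b');
  st_past_free : forall z v a b, y z < r -> active e y (y z) a b -> lo z = lo v ->
    y z <= y v -> ~~ in_window w v (C a b)
}.

(** Later rows change only the data of other vertices, so a finished vertex stays correct. *)
Lemma vertex_ok_ext X C P w X' C' P' w' v :
  X' v = X v -> (forall b, P' v b = P v b) -> (forall a, upward e y a v -> C' a v = C a v) ->
  (forall b, C' v b = C v b) -> (forall k, w' v k = w v k) ->
  vertex_ok X C P w v -> vertex_ok X' C' P' w' v.
Proof.
move=> EX EP EC1 EC2 Ew [h1 h2 h3 h4 h5].
have Ei a : in_window w' v a = in_window w v a by rewrite /in_window /window !Ew.
split.
- by move=> a b; rewrite !EP; exact: h1.
- move=> u h; have := h2 u h; rewrite /in_spec !EP EX EC1 //.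
  case: (P v u) => // -[? ? ? [u' g1 g2]]; split=> //.
  by exists u' => //; rewrite EP.
- by move=> b /h3; rewrite /out_spec EP EX EC2 !Ei.
- by rewrite EX Ei; case: h4 => [?|[u g1 g2]]; [left|right; exists u; rewrite ?EP].
- by rewrite EX.
Qed.

Lemma active_lt r a b : active e y r a b -> [/\ upward e y a b, y a < r & r <= y b].
Proof. by case/andP=> ? /andP[]. Qed.

Lemma same_block u v : lo u < y v <= y u -> lo u = lo v.
Proof.
have := y_lo u; have := y_lo v.
by case: (ltngtP (lo u) (lo v)) => // /y_block; lia.
Qed.

Definition used r C : seq nat :=
  [seq C p.1 p.2 | p <- enum [pred p : T * T | active e y r p.1 p.2]].

Definition unused r C : seq nat := [seq a <- iota 0 W | a \notin used r C].

(** The reserve in [cut_le] yields four free columns for each possible rank in a block. *)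
Lemma size_unused r C : 4 * K <= size (unused r C).
Proof.
have := cut_le r; rewrite cardE -(size_map (fun p => C p.1 p.2)) -/(used r C).
rewrite size_filter; have := count_predC (mem (used r C)) (iota 0 W); rewrite size_iota.
have -> : count (predC (mem (used r C))) (iota 0 W) = count (fun a => a \notin used r C) (iota 0 W).
  by apply: eq_count.
have : count (mem (used r C)) (iota 0 W) <= size (used r C).
  rewrite -size_filter; apply: uniq_leq_size; first by rewrite filter_uniq ?iota_uniq.
  by move=> a; rewrite mem_filter => /andP[].
lia.
Qed.

Lemma unused_sorted r C : sorted ltn (unused r C).
Proof. by apply: sorted_filter (iota_ltn_sorted _ _); exact: ltn_trans. Qed.

Lemma unused_nth r C i j : i < j < size (unused r C) ->
  nth 0 (unused r C) i < nth 0 (unused r C) j.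
Proof.
move=> /andP[ij js]; apply: (sorted_ltn_nth ltn_trans 0 (unused_sorted r C)) => //.
by rewrite inE (ltn_trans ij).
Qed.

Lemma mem_unused r C i : i < size (unused r C) ->
  nth 0 (unused r C) i < W /\ nth 0 (unused r C) i \notin used r C.
Proof.
by move=> /(mem_nth 0); rewrite mem_filter mem_iota => /andP[-> /andP[_ ->]].
Qed.

Lemma used_active r C a b : active e y r a b -> C a b \in used r C.
Proof. by move=> h; apply/mapP; exists (a, b); rewrite // mem_enum. Qed.

(* Covers both the first row of a block, where the windows of the whole block are fixed, and rows
   left empty, where nothing changes. *)
Lemma state_block r X C P w : (forall v, y v <> r) -> state r X C P w ->
  exists w', state r.+1 X C P w'.
Proof.
move=> nr S; pose F := unused r C.
have act a b : active e y r.+1 a b = active e y r a b.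
  rewrite /active; have := nr a; have := nr b => nb na; case: (upward _ _ _ _) => //=; lia.
pose w' v k := if lo v == r then nth 0 F (4 * (y v - lo v).-1 + k) else w v k.
have sF := size_unused r C; rewrite -/F in sF.
have uF i j : i < j < size F -> nth 0 F i < nth 0 F j by exact: unused_nth.
have idx v k : k < 4 -> 4 * (y v - lo v).-1 + k < size F by have := y_lo v; lia.
have wn v k : lo v = r -> w' v k = nth 0 F (4 * (y v - lo v).-1 + k) by move=> E; rewrite /w' E eqxx.
have wo v k : lo v <> r -> w' v k = w v k by move=> /eqP E; rewrite /w' (negbTE E).
have io v a : lo v <> r -> in_window w' v a = in_window w v a.
  by move=> E; rewrite /in_window /window !wo.
have inn v a b : lo v = r -> active e y r a b -> ~~ in_window w' v (C a b).
  move=> E /(used_active C) h; rewrite /in_window /window !wn //.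
  have notin k : k < 4 -> C a b != nth 0 F (4 * (y v - lo v).-1 + k).
    move=> /(idx v) /mem_unused[_]; apply: contra => /eqP <-; exact: h.
  by rewrite !inE !negb_or !notin.
exists w'; split.
- by move=> a b; rewrite act; exact: (st_lt S).
- by move=> a b a' b'; rewrite !act; exact: (st_inj S).
- move=> v hv; have [E|N] := eqVneq (lo v) r.
    rewrite !wn //; have i0 := idx v 0 isT; have i3 := idx v 3 isT.
    split; last by have [] := mem_unused i3.
      by apply/andP; split; apply: uF; lia.
    by apply: uF; lia.
  by move/eqP: N => N; rewrite !wo //; apply: (st_win S); lia.
- move=> u v E hu uv; have [Eu|N] := eqVneq (lo u) r.
    rewrite !wn -?E //; apply: uF.
    by have := idx v 0 isT; have := y_lo u; have := y_lo v; lia.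
  have N' : lo v <> r by rewrite -E; apply/eqP.
  by move/eqP: N => N; rewrite !wo //; apply: (st_sep S) => //; lia.
- move=> v a b hv; rewrite act; have [E|N] := eqVneq (lo v) r; first exact: inn.
  by move/eqP: N => N; rewrite io //; apply: (st_free S) => //; lia.
- move=> v hv; have hv' : y v < r by have := nr v; lia.
  apply: vertex_ok_ext (st_ok S hv') => // k; apply: wo; have := y_lo v; lia.
- by move=> z *; apply: (st_past_inj S) => //; have := nr z; lia.
- move=> z v a b hz h l zv; have zr : y z < r by have := nr z; lia.
  rewrite io; first exact: (st_past_free S zr h l zv).
  by have := y_lo z; lia.
Qed.

Lemma lo_not_y u v : lo u <> y v.
Proof.
have := y_lo u; have := y_lo v.
by case: (ltngtP (lo u) (lo v)) => [/y_block|/y_block|->]; lia.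
Qed.

Lemma degree_split v : #|[pred u | upward e y u v]| + #|[pred b | upward e y v b]| <= 4.
Proof.
rewrite -cardUI; apply: leq_trans (e_deg v).
rewrite [X in _ + X]eq_card0 => [|a]; last by rewrite !inE /upward; lia.
rewrite addn0; apply: subset_leq_card; apply/subsetP => a.
by rewrite !inE /upward => /orP[] /andP[h _] //; rewrite e_sym.
Qed.

(** Incoming edges are active in row [y v], hence in distinct columns outside the window, which is
    what [ports_exist] asks for. The chosen columns then have to be shown free above this row. *)
Lemma state_vertex v X C P w : state (y v) X C P w ->
  exists X' C' P', state (y v).+1 X' C' P' w.
Proof.
move=> S; set r := y v in S *.
pose ins := enum [pred u | upward e y u v]; pose outs := enum [pred b | upward e y v b].
have insP u : (u \in ins) = upward e y u v by rewrite mem_enum.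
have outsP b : (b \in outs) = upward e y v b by rewrite mem_enum.
have deg : size ins + size outs <= 4 by rewrite -!cardE; exact: degree_split.
pose cs := sort leq [seq C u v | u <- ins].
have actin u : upward e y u v -> active e y r u v.
  by move=> h; rewrite /active h (up_lt h) leqnn.
have Cinj u u' : upward e y u v -> upward e y u' v -> C u v = C u' v -> u = u'.
  by move=> h h' E; have [] := st_inj S (actin _ h) (actin _ h') E.
have csP a : reflect (exists2 u, upward e y u v & a = C u v) (a \in cs).
  rewrite mem_sort; apply: (iffP mapP) => -[u]; first by rewrite insP; exists u.
  by rewrite -insP; exists u.
have ucs : uniq cs.
  rewrite sort_uniq map_inj_in_uniq ?enum_uniq // => a b; rewrite !insP; exact: Cinj.
have scs : sorted ltn cs.
  by rewrite ltn_sorted_uniq_leq ucs (sort_sorted leq_total).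
have zcs : size cs = size ins by rewrite size_sort size_map.
have lv : lo v < r by have := y_lo v; rewrite -/r; lia.
have [w01 w23 w3] := st_win S lv.
have nw : all (fun a => a \notin window w v) cs.
  apply/allP => a /csP[u h ->]; apply: (st_free S) (actin _ h).
  by rewrite lv leqnn.
rewrite -zcs in deg.
have [X0 [pin [pout [co [[s1 s2 s3] u1 u2 pi po pX]]]]] := ports_exist w01 w23 scs deg nw.
pose X' a := if a == v then X0 else X a.
(* Incoming edges get their ports by the rank of their column, outgoing ones by their position in
   [outs]. *)
pose P' a b := if a == v then
  (if upward e y b v then nth PL pin (index (C b v) cs) else nth PL pout (index b outs)) else P a b.
pose C' a b := if a == v then nth 0 co (index b outs) else C a b.
have XE : X' v = X0 by rewrite /X' eqxx.
have Xo a : a != v -> X' a = X a by rewrite /X' => /negbTE->.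
have Po a b : a != v -> P' a b = P a b by rewrite /P' => /negbTE->.
have Co a b : a != v -> C' a b = C a b by rewrite /C' => /negbTE->.
have Pin u : upward e y u v -> P' v u = nth PL pin (index (C u v) cs) by rewrite /P' eqxx => ->.
have asym a b : upward e y a b -> upward e y b a = false.
  by move=> /up_lt h; apply/negP => /up_lt; lia.
have Pout b : upward e y v b -> P' v b = nth PL pout (index b outs).
  by move=> h; rewrite /P' eqxx asym.
have Cout b : C' v b = nth 0 co (index b outs) by rewrite /C' eqxx.
have upn a b : upward e y a b -> a != b.
  by move=> /up_lt h; apply: contraTneq h => ->; rewrite ltnn.
have Cin u : upward e y u v -> C' u v = C u v by move=> /upn/Co.
have iin u : upward e y u v -> index (C u v) cs < size cs.
  by move=> h; rewrite index_mem; apply/csP; exists u.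
have nin u : upward e y u v -> nth 0 cs (index (C u v) cs) = C u v.
  by move=> h; rewrite nth_index //; apply/csP; exists u.
have iout b : upward e y v b -> index b outs < size outs by move=> h; rewrite index_mem outsP.
have bottom i : i < size cs -> exists2 u, upward e y u v & index (C u v) cs = i.
  move=> hi; have /csP[u h E] := mem_nth 0 hi; exists u => //.
  by rewrite -E index_uniq.
have lty a : y a < r -> a != v by apply: contraTneq => ->; rewrite ltnn.
have pX' : in_window w v X0 \/ exists2 u, upward e y u v & P' v u = PB.
  case: pX => [|[i hi E]]; [by left|right].
  by have [u h Ei] := bottom i hi; exists u => //; rewrite Pin // Ei.
have X0W : X0 < W.
  case: pX => [|[i hi E]].
    by rewrite !inE => /or4P[] /eqP->; lia.
  have := pi i hi; rewrite /in_ok E => <-.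
  by have /csP[u /actin h ->] := mem_nth 0 hi; exact: (st_lt S h).
have outlt b : upward e y v b -> C' v b < W /\ (in_window w v (C' v b) \/ C' v b = X0).
  move=> h; have hb := iout b h.
  have := po _ hb; rewrite /out_ok Cout.
  have win a : in_window w v a -> a < W by rewrite /in_window !inE => /or4P[] /eqP->; lia.
  case: (nth PL pout _) => [[_ hw]|[_ hw]|->|[_ hw _]]; try by split; [exact: win|left].
  by split=> //; right.
have okv : vertex_ok X' C' P' w v.
  split; last by rewrite XE.
  - move=> a b ha hb.
    have nb c : e v c -> upward e y c v || upward e y v c.
      move=> h; rewrite /upward h e_sym h /=; case: (ltngtP (y c) (y v)) => // /y_inj E.
      by move: h; rewrite E e_irr.
    have [u3 u4 u5] : [/\ uniq pin, uniq pout & ~~ has (mem pin) pout].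
      by move: u1; rewrite cat_uniq => /and3P[].
    have io c d : upward e y c v -> upward e y v d -> P' v c = P' v d -> False.
      move=> hc hd; rewrite Pin // Pout // => E; case/hasP: u5.
      exists (nth PL pout (index d outs)); first by rewrite mem_nth // s2 iout.
      by rewrite -E /= mem_nth // s1 iin.
    case/orP: (nb _ ha) => ua; case/orP: (nb _ hb) => ub E.
    + move: E; rewrite !Pin // => /eqP; rewrite nth_uniq ?s1 ?iin // => /eqP E.
      by apply: Cinj => //; rewrite -nin // E nin.
    + by case: (io a b).
    + by case: (io b a).
    + move: E; rewrite !Pout // => /eqP; rewrite nth_uniq ?s2 ?iout // => /eqP E.
      by rewrite -[a](nth_index v (s := outs)) ?outsP // E nth_index ?outsP.
  - move=> u h; have := pi _ (iin u h).
    rewrite /in_spec /in_ok Pin // nin // Cin // XE.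
    case: (nth PL pin _) => // -[ne four bt]; split=> //.
    + by apply: full_last; rewrite cardE -/ins -zcs.
    + move=> b; rewrite -outsP; have : size outs = 0 by lia.
      by move/size0nil->.
    + have [j hj Ej] := nthP PL bt; rewrite s1 in hj.
      by have [u' h' E'] := bottom j hj; exists u' => //; rewrite Pin // E'.
  - move=> b h; split; last by have [] := outlt b h.
    have := po _ (iout b h); rewrite /out_spec /out_ok Pout // XE Cout.
    by case: (nth PL pout _).
  - by rewrite XE.
have act a b : active e y r.+1 a b -> (a = v /\ upward e y v b) \/ [/\ a != v, b != v & active e y r a b].
  case/active_lt=> h h1 h2; have [E|N] := eqVneq a v; first by left; rewrite -E.
  right; split=> //.
    by apply: contraTneq h2 => ->; rewrite ltnn.
  rewrite /active h (ltnW h2) andbT /= ltn_neqAle andbC -ltnS h1 /=.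
  by apply: contra_neq N => /y_inj.
(* A new column lies in the window, where no edge is active, or is that of [v]; outside the window
   the latter is held only by an edge ending in [v]. *)
have oldnew a b d : active e y r a b -> b != v -> upward e y v d -> C a b <> C' v d.
  move=> h nb hd E; have nW : ~~ in_window w v (C a b).
    by apply: (st_free S) h; rewrite lv leqnn.
  have [_ [hw|hx]] := outlt d hd; first by rewrite E hw in nW.
  case: pX => [hX|[i hi Ei]]; first by rewrite E hx /in_window hX in nW.
  have := pi i hi; rewrite /in_ok Ei; have [u hu <-] := bottom i hi; rewrite nin // => EX.
  have [_ Eb] := st_inj S h (actin u hu) (etrans E (etrans hx (esym EX))).
  by rewrite Eb eqxx in nb.
exists X', C', P'; split.
- move=> a b /act[[-> h]|[na nb h]]; first by have [] := outlt b h.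
  by rewrite Co //; exact: (st_lt S h).
- move=> a b a' b' /act[[-> h]|[na nb h]] /act[[-> h']|[na' nb' h']].
  + rewrite !Cout => /eqP; rewrite nth_uniq ?s3 ?iout // => /eqP E; congr pair.
    by rewrite -[b](nth_index v (s := outs)) ?outsP // E nth_index ?outsP.
  + by rewrite (Co a' b') // => E; case: (oldnew _ _ _ h' nb' h).
  + by rewrite (Co a b) // => E; case: (oldnew _ _ _ h nb h').
  + by rewrite !Co //; exact: (st_inj S h h').
- move=> u hu; apply: (st_win S); have := @lo_not_y u v; rewrite -/r; lia.
- move=> u u' E hu; apply: (st_sep S) => //; have := @lo_not_y u v; rewrite -/r; lia.
- move=> u a b hu h; have lu : lo u < r by have := @lo_not_y u v; rewrite -/r; lia.
  have E : lo u = lo v.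
    by apply: same_block; rewrite -/r lu; lia.
  have sep := st_sep S (esym E) lv (v := u); rewrite -/r in sep.
  have wu := st_win S lu.
  have old c d : active e y r c d -> ~~ in_window w u (C c d).
    by apply: (st_free S); lia.
  have disj c : in_window w v c -> ~~ in_window w u c.
    case: wu => wa wb wc; have {}sep := sep ltac:(lia).
    by rewrite /in_window !inE => /or4P[] /eqP->; lia.
  case: (act _ _ h) => [[-> hb]|[na nb h']]; last by rewrite Co //; exact: old.
  have [_ [hw|->]] := outlt b hb; first exact: disj.
  case: pX => [hX|[i hi Ei]]; first exact: disj.
  have := pi i hi; rewrite /in_ok Ei; have [u' hu' <-] := bottom i hi; rewrite nin // => <-.
  exact/old/actin.
- move=> u hu; have [->|N] := eqVneq u v; first exact: okv.
  have lu : y u < r by rewrite ltn_neqAle -ltnS hu andbT; apply: contra_neq N => /y_inj.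
  apply: vertex_ok_ext (st_ok S lu) => //.
  + exact: Xo.
  + by move=> b; exact: Po.
  + by move=> a /up_lt h; apply/Co/lty; lia.
  + by move=> b; exact: Co.
- move=> z a b a' b' hz h h'.
  have [_ h1 _] := active_lt h; have [_ h2 _] := active_lt h'.
  rewrite !Co; try by apply: lty; lia.
  have [E|N] := eqVneq z v; first by rewrite E in h h'; exact: (st_inj S h h').
  by apply: (st_past_inj S _ h h'); rewrite ltn_neqAle -ltnS hz andbT; apply: contra_neq N => /y_inj.
- move=> z u a b hz h E zu; have [_ h1 _] := active_lt h.
  rewrite Co; last by apply: lty; lia.
  have [Ez|N] := eqVneq z v.
    rewrite Ez in h E zu; apply: (st_free S) h; rewrite -/r in zu *.
    by rewrite -E lv.
  by apply: (st_past_free S _ h) => //; rewrite ltn_neqAle -ltnS hz andbT; apply: contra_neq N => /y_inj.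
Qed.

Lemma state_exists r : exists X C P w, state r X C P w.
Proof.
elim: r => [|r [X [C [P [w S]]]]].
  (* Below row 0 no edge is active and no block has begun, so any values do. *)
  exists (fun=> 0), (fun _ _ => 0), (fun _ _ => PL), (fun _ _ => 0).
  by split=> //; try (by move=> *; lia); move=> a b; rewrite /active ltn0 andbF.
have [v /eqP E|nv] := pickP (fun v => y v == r).
  by move: S; rewrite -E => /state_vertex[X' [C' [P' S']]]; exists X', C', P', w.
have [w' S'] := state_block (fun v => elimF eqP (nv v)) S.
by exists X, C, P, w'.
Qed.

Lemma layout_exists : exists X C P Win,
  [/\ layout e K y lo X C P Win, forall v, X v < W & forall u v, upward e y u v -> C u v < W].
Proof.
have [X [C [P [w S]]]] := state_exists (\max_v (y v)).+1.
have ly v : y v < (\max_v (y v)).+1 by rewrite ltnS (leq_bigmax v).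
exists X, C, P, (in_window w); split.
- split=> //.
  + by move=> z *; apply: (st_past_inj S (ly z)).
  + by move=> z *; apply: (st_past_free S (ly z)).
  + move=> u v a b E uv; have lv : lo v < (\max_v (y v)).+1 by have := y_lo v; have := ly v; lia.
    rewrite -E in lv; have := st_sep S E lv uv; have := st_win S lv.
    rewrite E in lv; have := st_win S lv.
    by rewrite /in_window !inE => -[? ? _] [? ? _] ? /or4P[] /eqP-> /or4P[] /eqP->; lia.
  + by move=> v a b; apply: (ok_port (st_ok S (ly v))).
  + by move=> u v; apply: (ok_in (st_ok S (ly v))).
  + by move=> v b h; have [] := ok_out (st_ok S (ly v)) h.
  + by move=> v; apply: (ok_col (st_ok S (ly v))).
- by move=> v; apply: (ok_lt (st_ok S (ly v))).
- by move=> u b h; have [] := ok_out (st_ok S (ly u)) h.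
Qed.

End Exists.

(** * Orders with small cuts *)

Section Order.
Variables (T : finType) (e : rel T).
Hypotheses (e_sym : symmetric e) (e_deg : max_degree_le e 4).
Hypothesis e_conn : forall x y, connect e x y.

Implicit Types (A S Q Z : {set T}) (s q : seq T).

Definition inside A : rel T := [rel a b | [&& e a b, a \in A & b \in A]].

(** The component of [a] in the graph induced on [A]; for [a] outside [A] it is just the
    singleton. *)
Definition comp A a : {set T} := [set b | connect (inside A) a b].

Lemma insideE A a b : inside A a b = [&& e a b, a \in A & b \in A].
Proof. by []. Qed.

Lemma inside_sym A : symmetric (inside A).
Proof. by move=> a b; rewrite !insideE e_sym [(a \in A) && _]andbC. Qed.

Lemma comp_closed A Z a : a \in Z -> (forall b c, b \in Z -> inside A b c -> c \in Z) ->
  comp A a \subset Z.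
Proof.
move=> aZ cl; apply/subsetP => b; rewrite inE => /connectP[p hp ->] {b}.
by elim: p a aZ hp => //= b p IH a aZ /andP[h1 h2]; exact: IH (cl _ _ aZ h1) h2.
Qed.

Lemma comp_refl A a : a \in comp A a.
Proof. by rewrite inE connect0. Qed.

Lemma comp_step A a b c : b \in comp A a -> inside A b c -> c \in comp A a.
Proof. by rewrite !inE => h1 h2; apply: connect_trans h1 (connect1 h2). Qed.

Lemma comp_sub A a : a \in A -> comp A a \subset A.
Proof. by move=> aA; apply: comp_closed => // b c _ /and3P[]. Qed.

Lemma comp_eq A a b : b \in comp A a -> comp A b = comp A a.
Proof.
rewrite inE => h; apply/setP => c; rewrite !inE.
by rewrite (same_connect (sym_connect_sym (inside_sym A)) h).
Qed.

Lemma comp_sym A a b : b \in comp A a -> a \in comp A b.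
Proof. by move=> /comp_eq->; exact: comp_refl. Qed.

Lemma comp_mono A Z a : comp A a \subset Z -> Z \subset A -> comp A a \subset comp Z a.
Proof.
move=> h1 h2; apply: comp_closed; first exact: comp_refl.
move=> b c hb hbc; have [ebc bA cA] := and3P hbc.
have h3 : comp Z a \subset comp A a.
  apply: comp_closed; first exact: comp_refl.
  move=> b' c' hb' /and3P[h bZ cZ]; apply: comp_step hb' _.
  by rewrite insideE h !(subsetP h2).
have bc := subsetP h3 _ hb.
by apply: (comp_step hb); rewrite insideE ebc !(subsetP h1) // (comp_step bc hbc).
Qed.

Definition deg_in S v : nat := #|[set u in S | e u v]|.

(** Counts the edges between [S] and its complement, each at its outer end. *)
Definition cut S : nat := \sum_(v | v \notin S) deg_in S v.

Lemma deg_in_lt S v u : e v u -> u \notin S -> deg_in S v < 4.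
Proof.
move=> h nu; apply: leq_trans (e_deg v); apply: proper_card; apply/properP; split.
  by apply/subsetP => a; rewrite !inE e_sym => /andP[].
by exists u; rewrite !inE // (negbTE nu).
Qed.

Lemma deg_inU S Q v : [disjoint S & Q] -> deg_in (S :|: Q) v = deg_in S v + deg_in Q v.
Proof.
move=> d; rewrite /deg_in -cardsUI.
rewrite (_ : _ :&: _ = set0) ?cards0 ?addn0.
  by apply: eq_card => u; rewrite !inE andb_orl.
apply/setP => u; rewrite !inE; apply/negP => /andP[/andP[h1 _] /andP[h2 _]].
by rewrite (disjointFr d h1) in h2.
Qed.

Lemma sum_deg_in Q : \sum_v deg_in Q v <= 4 * #|Q|.
Proof.
have -> : \sum_v deg_in Q v = \sum_(u in Q) #|[pred v | e u v]|.
  under eq_bigr do rewrite /deg_in -sum1_card.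
  under [RHS]eq_bigr do rewrite -sum1_card.
  rewrite (exchange_big_dep (mem Q)) /=; last by move=> v u _; rewrite inE => /andP[].
  by apply: eq_bigr => u uQ; apply: eq_bigl => v; rewrite !inE uQ.
by rewrite mulnC -sum_nat_const; apply: leq_sum => u _; exact: e_deg.
Qed.

Lemma cut_grow S Q : [disjoint S & Q] -> cut (S :|: Q) <= cut S + 4 * #|Q|.
Proof.
move=> d; rewrite /cut; under eq_bigr do rewrite deg_inU //.
rewrite big_split /=; apply: leq_add; last first.
  apply: leq_trans (sum_deg_in Q).
  by rewrite [X in _ <= X](bigID (fun v => v \notin S :|: Q)) leq_addr.
rewrite [X in _ <= X](bigID (fun v => v \notin Q)) /=.
apply: leq_trans (leq_addr _ _); apply: eq_leq; apply: eq_bigl => v.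
by rewrite inE negb_or.
Qed.

(* The edges at [Q] end in [S], [Q] or [x], so only the edges at [x] can make the cut grow. *)
Lemma cut_macro S Q x : x \notin S -> x \notin Q -> [disjoint S & Q] ->
  (forall a b, a \in Q -> b \notin S :|: Q -> e a b -> b = x) ->
  cut (S :|: (x |: Q)) + 2 * deg_in S x <= cut S + 4.
Proof.
move=> xS xQ d cl.
have d' : [disjoint S & x |: Q].
  rewrite -setI_eq0; apply/eqP/setP => a; rewrite !inE.
  case: eqVneq => [->|_] /=; first by rewrite (negbTE xS).
  by case aS: (a \in S) => //=; rewrite (disjointFr d aS).
rewrite /cut; under eq_bigr do rewrite deg_inU //.
rewrite big_split /= [X in _ <= X + _](bigD1 x) //=.
have -> : \sum_(i | i \notin S :|: (x |: Q)) deg_in (x |: Q) i =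
          #|[set i | (i \notin S :|: (x |: Q)) && e x i]|.
  rewrite -sum1_card [RHS](eq_bigl (fun i => (i \notin S :|: (x |: Q)) && e x i)); last by move=> i; rewrite inE.
  rewrite big_mkcondr /=; apply: eq_bigr => i; rewrite !inE !negb_or => /and3P[iS ix iQ].
  rewrite /deg_in; case: ifP => h.
    rewrite (_ : [set u in x |: Q | e u i] = [set x]) ?cards1 //.
    apply/setP => u; rewrite !inE; apply/idP/eqP => [/andP[/orP[/eqP//|uQ] eui]|->].
      by move: ix; rewrite (cl u i) ?eqxx // inE negb_or iS.
    by rewrite eqxx h.
  apply/eqP; rewrite cards_eq0; apply/eqP/setP => u; rewrite !inE; apply/negP.
  move=> /andP[/orP[/eqP->|uQ] eui]; first by rewrite h in eui.
  by move: ix; rewrite (cl u i) ?eqxx // inE negb_or iS.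
have h1 : \sum_(i | i \notin S :|: (x |: Q)) deg_in S i <= \sum_(i | (i \notin S) && (i != x)) deg_in S i.
  rewrite [X in _ <= X](bigID (fun v => v \notin Q)) /=.
  apply: leq_trans (leq_addr _ _); apply: eq_leq; apply: eq_bigl => v.
  by rewrite !inE !negb_or andbA.
(* These two sets of neighbours of [x] are disjoint. The cut therefore loses [deg_in S x] and gains
   at most [4 - deg_in S x]. *)
have h2 : #|[set i | (i \notin S :|: (x |: Q)) && e x i]| + deg_in S x <= 4.
  rewrite /deg_in -cardsUI (_ : _ :&: _ = set0) ?cards0 ?addn0; last first.
    by apply/setP => i; rewrite !inE; case: (i \in S); rewrite /= ?andbF.
  apply: leq_trans (e_deg x); apply: subset_leq_card; apply/subsetP => i.
  by rewrite !inE [e i x]e_sym => /orP[] /andP[].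
by rewrite mul2n -addnn; move: h1 h2; set a := \sum_(i | _) _; set b := #|_|; set c := \sum_(i | _) _; lia.
Qed.

Lemma frontier S : S != set0 -> S != setT -> exists2 x, x \notin S & 0 < deg_in S x.
Proof.
case/set0Pn=> a aS nT.
have [b bS] : exists b, b \notin S.
  by apply/existsP; apply: contraNT nT; rewrite negb_exists => /forallP h;
     apply/eqP/setP => b; rewrite inE; have := h b; rewrite negbK.
have [x /andP[x1 x2]|no] := pickP [pred x | (x \notin S) && (0 < deg_in S x)].
  by exists x.
case/negP: bS; have /connectP[p hp ->] := e_conn a b.
elim: p a aS hp => //= c p IH a aS /andP[h1 h2]; apply: IH (h2).
have := no c; rewrite inE; case: (c \in S) => //= /negbT; rewrite -eqn0Ngt cards_eq0 => /eqP E.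
have : a \in [set u in S | e u c] by rewrite inE aS h1.
by rewrite E inE.
Qed.

(** Here [c] stands for the cut after the step. A vertex with two neighbours in [S] gives
    [c <= cut S]. If there is none, [cut S] is at most n - |S|; combined with
    [cut S <= 2 * #|S| + 2] this gives 3 [cut S] <= 2n + 2, which leaves room for a growth by 2.
    From the empty set the cut becomes at most 4. *)
Lemma choose_next S : 1 < #|T| -> S != setT ->
  cut S <= 2 * #|S| + 2 -> 3 * cut S <= 2 * #|T| + 8 ->
  exists2 x, x \notin S & forall c, c + 2 * deg_in S x <= cut S + 4 ->
    c <= 2 * #|S| + 4 /\ 3 * c <= 2 * #|T| + 8.
Proof.
move=> n1 nT c1 c2.
have [x /andP[xS x2]|no] := pickP [pred x | (x \notin S) && (1 < deg_in S x)].
  by exists x => // c; lia.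
have [E|N] := eqVneq S set0.
  have [x _] : exists x : T, x \in T by apply/card_gt0P; exact: ltnW.
  exists x; first by rewrite E inE.
  have -> : cut S = 0.
    by rewrite /cut big1 // => v _; apply/eqP; rewrite cards_eq0; apply/eqP/setP => u; rewrite E !inE.
  by move=> c; lia.
have [x xS x0] := frontier N nT; exists x => // c h.
have : cut S <= #|~: S|.
  rewrite -sum1_card /cut [X in _ <= X](eq_bigl (fun v => v \notin S)); last by move=> v; rewrite inE.
  by apply: leq_sum => v vS; have := no v; rewrite inE vS /=; lia.
have := cardsC S; lia.
Qed.

(** The order is built from its end: the vertex picked from [V] becomes the last of [V], and its
    neighbour lies in [Z] or among those placed after it. *)
Lemma order_towards (U Z : {set T}) :
  (forall V : {set T}, V \subset U -> V != set0 -> exists v u, [/\ v \in V, e v u & u \in Z :|: (U :\: V)]) ->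
  exists q, [/\ uniq q, q =i U & forall v, v \in U ->
    exists2 u, e v u & u \in Z \/ (u \in U /\ index v q < index u q)].
Proof.
move=> step.
suff H n (V : {set T}) : #|V| = n -> V \subset U -> exists q, [/\ uniq q, q =i V & forall v, v \in V ->
    exists2 u, e v u & u \in Z :|: (U :\: V) \/ (u \in V /\ index v q < index u q)].
  have [q [q1 q2 q3]] := H _ U erefl (subxx _).
  exists q; split=> // v /q3[u h1 h2]; exists u => //.
  by case: h2; [rewrite setDv setU0; left|right].
elim: n V => [|n IH] V cV sV.
  exists [::]; split=> //; first by move=> v; rewrite (cards0_eq cV) inE.
  by move=> v; rewrite (cards0_eq cV) inE.
have [|v [u [vV evu uZ]]] := step V sV; first by rewrite -card_gt0 cV.
have [||q [q1 q2 q3]] := IH (V :\ v).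
- by move: cV; rewrite (cardsD1 v) vV => -[].
- by apply: subset_trans sV; exact: subsetDl.
exists (rcons q v); have vq : v \notin q by rewrite q2 !inE eqxx.
have iv : index v (rcons q v) = size q by rewrite -cats1 index_cat (negbTE vq) /= eqxx addn0.
have iq a : a \in q -> index a (rcons q v) = index a q.
  by move=> aq; rewrite -cats1 index_cat aq.
split.
- by rewrite rcons_uniq vq.
- by move=> a; rewrite mem_rcons inE q2 !inE; case: eqVneq => [->|].
move=> a aV; have [->|N] := eqVneq a v; first by exists u => //; left.
have aq : a \in q by rewrite q2 !inE N.
have [|b eab hb] := q3 a; first by rewrite -q2.
exists b => //; case: hb => [|[bV lt]].
  rewrite !inE negb_and negbK => /orP[->|]; first by left.
  case/andP=> /orP[/eqP->|nb] bU; last by left; rewrite nb bU orbT.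
  by right; rewrite vV iv iq // index_mem.
have bq : b \in q by rewrite q2.
by right; rewrite !iq //; split=> //; move: bV; rewrite inE => /andP[].
Qed.

(** * Small components left behind by one vertex *)

Section Macro.
Variables (S : {set T}) (x : T) (m : nat).
Hypothesis xS : x \notin S.
Hypothesis big : forall b, b \notin S -> m <= #|comp (~: S) b|.

Let R := ~: S.
Let R1 := R :\ x.

(** These vertices are appended just before [x], so that all components of the remaining graph keep
    at least [m] vertices. *)
Definition small : {set T} := [set b in R1 | (b \in comp R x) && (#|comp R1 b| < m)].

Let smallP b : b \in small -> [/\ b \notin S, b != x, b \in comp R x & #|comp R1 b| < m].
Proof. by rewrite !inE => /and3P[/andP[-> ->] -> ->]. Qed.

Lemma x_notin_small : x \notin small.
Proof. by rewrite !inE eqxx. Qed.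

Lemma small_disjoint : [disjoint S & small].
Proof.
rewrite -setI_eq0; apply/eqP/setP => a; rewrite !inE.
by case: (a \in S); rewrite /= ?andbF.
Qed.

Lemma small_closed a b : a \in small -> b \notin S :|: small -> e a b -> b = x.
Proof.
move=> aQ; rewrite inE negb_or => /andP[bS bQ] eab; apply/eqP; apply: contraNT bQ => nbx.
have [aS ax ac am] := smallP aQ.
have aR1 : a \in R1 by rewrite !inE ax aS.
have bR1 : b \in R1 by rewrite !inE nbx bS.
have h1 : b \in comp R1 a by apply: comp_step (comp_refl _ _) _; rewrite insideE eab aR1 bR1.
rewrite inE bR1 (comp_eq h1) am andbT /=.
by apply: comp_step ac _; rewrite insideE eab !inE aS bS.
Qed.

Lemma comp_touches b : b \in small -> exists2 c, e x c & c \in comp R1 b.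
Proof.
move=> bQ; have [bS bx bc bm] := smallP bQ.
have [c /andP[c1 c2]|no] := pickP [pred c | e x c && (c \in comp R1 b)]; first by exists c.
have bR1 : b \in R1 by rewrite !inE bx bS.
have sub : comp R b \subset comp R1 b.
  apply: comp_closed; first exact: comp_refl.
  move=> a c ha /and3P[eac aR cR]; apply: (comp_step ha); rewrite insideE eac.
  rewrite (subsetP (comp_sub bR1)) //= !inE; move: cR; rewrite inE => ->; rewrite andbT.
  by apply: contraT; rewrite negbK => /eqP E; have := no a; rewrite /= -E e_sym eac ha.
have := subsetP (comp_sub bR1) x (subsetP sub _ (comp_sym bc)).
by rewrite !inE eqxx.
Qed.

(** Each small component contains one of the at most four neighbours of [x]. *)
Lemma small_card : #|small| <= 4 * m.
Proof.
have sub : small \subset \bigcup_(c in [pred c | e x c & #|comp R1 c| < m]) comp R1 c.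
  apply/subsetP => b bQ; have [c exc cb] := comp_touches bQ.
  have [_ _ _ bm] := smallP bQ.
  by apply/bigcupP; exists c; [rewrite inE exc (comp_eq cb)|exact: comp_sym].
apply: leq_trans (subset_leq_card sub) _.
apply: (@leq_trans (\sum_(c in [pred c | e x c & #|comp R1 c| < m]) #|comp R1 c|)).
  apply: (big_ind2 (fun (A : {set T}) k => #|A| <= k)) => //; first by rewrite cards0.
  by move=> A k B l hA hB; apply: leq_trans (leq_card_setU A B) (leq_add hA hB).
apply: (@leq_trans (\sum_(c in [pred c | e x c & #|comp R1 c| < m]) m)).
  by apply: leq_sum => c; rewrite inE => /andP[_ /ltnW].
rewrite sum_nat_const leq_mul2r; apply/orP; right; apply: leq_trans (e_deg x).
by apply: subset_leq_card; apply/subsetP => c; rewrite !inE => /andP[].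
Qed.

(** Otherwise [V] would be closed under adjacency outside [S] and would contain the whole component
    of its vertices, hence [x]. *)
Lemma small_step (V : {set T}) : V \subset small -> V != set0 ->
  exists v u, [/\ v \in V, e v u & u \in [set x] :|: (small :\: V)].
Proof.
move=> sV /set0Pn[b bV].
have [/existsP[v /existsP[u /and3P[? ? ?]]]|] :=
  boolP [exists v, exists u, [&& v \in V, e v u & u \in [set x] :|: (small :\: V)]].
  by exists v, u.
rewrite negb_exists => /forallP no.
have cl v u : v \in V -> e v u -> u \notin S -> u \in V.
  move=> vV evu uS; have := no v; rewrite negb_exists => /forallP /(_ u).
  rewrite vV evu in_setU in_set1 in_setD negb_or negb_and negbK /= => /andP[ux /orP[//|uQ]].
  have := small_closed (subsetP sV _ vV) _ evu; rewrite inE negb_or uS.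
  by move=> /(_ uQ) E; rewrite E eqxx in ux.
have bQ := subsetP sV _ bV; have [bS _ bc _] := smallP bQ.
have : x \in V.
  apply: (subsetP _ _ (comp_sym bc)); apply: comp_closed bV _ => v u vV /and3P[evu _].
  by rewrite inE; exact: cl vV evu.
by move=> /(subsetP sV); rewrite (negbTE x_notin_small).
Qed.

Let S' := S :|: (x |: small).

(** In the old component of [x] the surviving pieces are those that were not small; every other
    component is untouched. *)
Lemma big_after b : b \notin S' -> m <= #|comp (~: S') b|.
Proof.
rewrite in_setU in_setU1 !negb_or => /and3P[bS bx bQ].
have bR : b \in R by rewrite inE.
have bR1 : b \in R1 by rewrite !inE bx bS.
have S'R1 : ~: S' \subset R1.
  by apply/subsetP => a; rewrite !inE !negb_or => /and3P[-> ->].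
have S'R : ~: S' \subset R by apply/subsetP => a /(subsetP S'R1); rewrite inE => /andP[].
have [bc|nbc] := boolP (b \in comp R x).
  have bm : m <= #|comp R1 b|.
    by move: bQ; rewrite in_set bR1 bc /= -leqNgt.
  apply: (leq_trans bm); apply/subset_leq_card/comp_mono => //.
  apply/subsetP => a ab; have aR1 := subsetP (comp_sub bR1) _ ab.
  rewrite in_setC in_setU in_setU1 !negb_or; move: (aR1); rewrite !inE => /andP[-> ->] /=.
  by rewrite (comp_eq ab) ltnNge bm /= !andbF.
apply: (leq_trans (big bS)); apply/subset_leq_card/comp_mono => //.
apply/subsetP => a ab; have aR := subsetP (comp_sub bR) _ ab.
have nac : a \notin comp R x.
  by apply: contra nbc => h; rewrite -(comp_eq h); exact: comp_sym.
move: aR; rewrite in_setC in_setU in_setU1 in_setC !negb_or => -> /=; apply/andP; split.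
  by apply: contraNneq nac => ->; exact: comp_refl.
by rewrite in_set (negbTE nac) andbF.
Qed.

(** Under this assumption [x] and [small] contain the entire component of [x], which has at least
    [m] vertices. A vertex without later neighbours is thus paid for by [m] appended vertices. *)
Lemma closed_big : (forall u, e x u -> u \in S :|: small) -> m <= #|small|.+1.
Proof.
move=> h; apply: (leq_trans (big xS)).
have -> : #|small|.+1 = #|x |: small| by rewrite cardsU1 x_notin_small.
apply/subset_leq_card/comp_closed; first by rewrite !inE eqxx.
move=> a b ha /and3P[eab _]; rewrite inE => bS.
have [->|nx] := eqVneq b x; first by rewrite !inE eqxx.
have [bQ|nQ] := boolP (b \in small); first by rewrite inE bQ orbT.
case/setU1P: ha => [E|aQ].
  by subst a; have := h _ eab; rewrite inE (negbTE bS) (negbTE nQ).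
have := small_closed aQ _ eab; rewrite inE negb_or bS nQ => /(_ isT) E.
by rewrite E eqxx in nx.
Qed.

End Macro.

(** * The greedy order *)

Definition before s v : {set T} := [set u in take (index v s) s].

Definition full s v : bool := deg_in (before s v) v == 4.

(** The sharp bounds hold only at the ends of completed steps. Other prefixes exceed such an end by
    at most [4 * m + 1] vertices with four edges each, which gives the slack [12 * (4 * m + 1)] in
    [gr_cuts]. *)
Record greedy (m : nat) s : Prop := Greedy {
  gr_uniq : uniq s;
  gr_cuts : forall k, 3 * cut [set u in take k s] <= 2 * #|T| + 12 * (4 * m + 1) + 8;
  gr_cut1 : cut [set u in s] <= 2 * size s + 2;
  gr_cut2 : 3 * cut [set u in s] <= 2 * #|T| + 8;
  gr_full : count (full s) s * m <= size s;
  gr_big : forall b, b \notin s -> m <= #|comp (~: [set u in s]) b|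
}.

Lemma cut0 : cut set0 = 0.
Proof.
rewrite /cut big1 // => v _; apply/eqP; rewrite cards_eq0; apply/eqP/setP => u.
by rewrite !inE.
Qed.

Lemma set_nil : [set u in [::] : seq T] = set0 :> {set T}.
Proof. by apply/setP => u; rewrite !inE. Qed.

Lemma greedy_nil m : m <= #|T| -> greedy m [::].
Proof.
move=> hm; split=> //=; rewrite ?set_nil ?cut0 // => b _.
apply: leq_trans hm _; rewrite -cardsT; apply/subset_leq_card/subsetP => c _.
rewrite inE; apply: connect_sub (e_conn b c) => u v uv; apply: connect1.
by rewrite insideE uv !inE.
Qed.

(** The step appends the small components, ordered towards [x], and then [x]. Each vertex before [x]
    has a later neighbour, so only [x] can become full, and then [closed_big] applies. *)
Lemma greedy_step m s : 1 < #|T| -> greedy m s -> size s < #|T| ->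
  exists2 s', greedy m s' & size s < size s'.
Proof.
move=> n1 [us hcuts hc1 hc2 hfull hbig] lt; pose S := [set u in s].
have cS : #|S| = size s by rewrite cardsE; apply/card_uniqP.
have inS u : (u \in S) = (u \in s) by rewrite inE.
have nT : S != setT by apply: contraTneq lt => E; rewrite -cS E cardsT ltnn.
rewrite -/S -cS in hc1 hc2.
have [x xS hx] := choose_next n1 nT hc1 hc2.
have bigS b : b \notin S -> m <= #|comp (~: S) b| by rewrite inS; exact: hbig.
pose Q := small S x m.
have [q [uq qQ hq]] := order_towards (@small_step S x m).
have xQ : x \notin Q := x_notin_small S x m.
have dSQ : [disjoint S & Q] := small_disjoint S x m.
have cQ : #|Q| <= 4 * m := small_card S x m.
have sq : size q = #|Q| by rewrite -(card_uniqP uq); apply: eq_card => u; rewrite qQ.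
pose s' := s ++ rcons q x.
have S'E : [set u in s'] = S :|: (x |: Q).
  by apply/setP => u; rewrite in_setU in_setU1 inS in_set mem_cat mem_rcons inE qQ.
have us' : uniq s'.
  rewrite cat_uniq us rcons_uniq uq andbT qQ xQ andbT; apply/hasPn => u.
  rewrite mem_rcons inE qQ /= -inS => /orP[/eqP->//|uQ].
  by rewrite (disjointFl dSQ uQ).
have zs' : size s' = size s + #|Q|.+1 by rewrite size_cat size_rcons sq.
have mac := cut_macro xS xQ dSQ (@small_closed S x m).
have [c1 c2] := hx _ mac.
have index_s v : v \in s -> index v s' = index v s by move=> vs; rewrite index_cat vs.
have index_q v : v \in q -> index v s' = size s + index v q.
  move=> vq; have vs : v \notin s by rewrite -inS (disjointFl dSQ) // -qQ.
  by rewrite index_cat (negbTE vs) -cats1 index_cat vq.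
have index_x : index x s' = size s + size q.
  rewrite index_cat -inS (negbTE xS) -cats1 index_cat qQ (negbTE xQ) /= eqxx addn0 //.
have nbefore u v : u \in s' -> index v s' < index u s' -> u \notin before s' v.
  by move=> us0 lt'; rewrite inE in_take // -leqNgt ltnW.
have full_s v : v \in s -> full s' v = full s v.
  move=> vs; rewrite /full /before index_s // takel_cat //.
  by rewrite ltnW // index_mem.
have full_q v : v \in q -> full s' v = false.
  move=> vq; have [|u evu hu] := hq v; first by rewrite -qQ.
  suff h : u \notin before s' v by rewrite /full; have := deg_in_lt evu h; case: eqP => // ->.
  case: hu => [/set1P->|[uQ lt']]; apply: nbefore.
  - by rewrite mem_cat mem_rcons mem_head orbT.
  - by rewrite index_x index_q // ltn_add2l index_mem.
  - by rewrite mem_cat mem_rcons inE qQ uQ !orbT.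
  - by rewrite (index_q v vq) (index_q u) ?qQ // ltn_add2l.
have before_x : before s' x = S :|: Q.
  rewrite /before index_x take_cat ltnNge leq_addr /= addKn -cats1 take_size_cat //.
  by apply/setP => u; rewrite in_setU inS in_set mem_cat qQ.
have countE : count (full s') s' = count (full s) s + full s' x.
  rewrite count_cat -cats1 count_cat /= addn0 (eq_in_count full_s).
  by rewrite (@eq_in_count _ _ pred0 q) ?count_pred0.
exists s'; last by rewrite zs'; lia.
split=> //.
- move=> k; have [hk|hk] := leqP k (size s); first by rewrite takel_cat //; exact: hcuts.
  have [k' E] : exists k', take k s' = s ++ take k' (rcons q x).
    by exists (k - size s); rewrite take_cat ltnNge (ltnW hk).
  pose V := [set u in take k' (rcons q x)].
  have -> : [set u in take k s'] = S :|: V by rewrite E; apply/setP => u; rewrite in_setU !in_set mem_cat.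
  have dV : [disjoint S & V].
    rewrite -setI_eq0; apply/eqP/setP => u; rewrite !in_set; apply/negP => /andP[u1 u2].
    move: us'; rewrite cat_uniq => /and3P[_ /hasPn h _].
    by have := h u (mem_take u2); rewrite /= u1.
  have cV : #|V| <= 4 * m + 1.
    apply: (@leq_trans (size (rcons q x))); last by rewrite size_rcons sq addn1.
    rewrite cardsE; apply: leq_trans (card_size _) _.
    by rewrite size_take; case: ltnP; lia.
  have := cut_grow dV; lia.
- by rewrite S'E zs'; lia.
- by rewrite S'E.
- rewrite countE zs'; case fx: (full s' x); last by lia.
  have : m <= #|Q|.+1.
    apply: closed_big => // u exu; rewrite -before_x; apply: contraT => nu.
    by move: fx; rewrite /full; have := deg_in_lt exu nu; case: eqP => // ->.
  lia.
- move=> b; rewrite S'E => bs'; apply: big_after => //.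
  by rewrite -S'E in_set.
Qed.

Lemma greedy_exists m : 1 < #|T| -> m <= #|T| ->
  exists2 s, greedy m s & forall x, x \in s.
Proof.
move=> n1 hm.
suff H k : k <= #|T| -> exists2 s, greedy m s & k <= size s.
  have [s gs ss] := H _ (leqnn _); exists s => // x.
  have/card_uniqP cs := gr_uniq gs.
  have := subset_cardP (_ : #|s| = #|T|) (subset_predT _) => -> //.
  by apply/eqP; rewrite eqn_leq max_card cs.
elim: k => [|k IH] hk; first by exists [::] => //; exact: greedy_nil.
have [s gs ss] := IH (ltnW hk).
have [lt|ge] := ltnP (size s) #|T|; last by exists s => //; exact: leq_trans hk ge.
have [s' gs' ss'] := greedy_step n1 gs lt; exists s' => //; exact: leq_ltn_trans ss ss'.
Qed.

End Order.

(** * Rows *)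

Section Slots.
Variables (K : nat) (f : nat -> bool).
Hypothesis K0 : 0 < K.

(* Block number and rank in the block; ranks start at 1, and a flagged position closes its block. *)
Fixpoint slot (i : nat) : nat * nat :=
  if i is i'.+1 then
    let: (b, j) := slot i' in if (j == K) || f i' then (b.+1, 1) else (b, j.+1)
  else (0, 1).

Lemma slot_rank i : 0 < (slot i).2 <= K.
Proof.
elim: i => //= i; case: (slot i) => b j /= h.
by case: ifP => //= /negbT; rewrite negb_or; lia.
Qed.

Lemma slot_lt i i' : i < i' ->
  (slot i).1 < (slot i').1 \/ [/\ ~~ f i, (slot i).1 = (slot i').1 & (slot i).2 < (slot i').2].
Proof.
elim: i' => // i' IH; rewrite ltnS leq_eqVlt => h /=.
have step : (slot i').1 < (slot i'.+1).1 \/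
    [/\ ~~ f i', (slot i').1 = (slot i'.+1).1 & (slot i').2 < (slot i'.+1).2].
  rewrite /=; case: (slot i') => b j /=; case: ifP => [|/negbT]; first by left.
  by rewrite negb_or => /andP[_ ?]; right.
case/orP: h => [/eqP->//|/IH]; move: step => /=; case: (slot i') => b j /=.
case: ifP => _ /= [s1|[s1 s2 s3]] [t1|[t1 t2 t3]]; try by left; lia.
by right; split=> //; lia.
Qed.

(** Each flagged position wastes fewer than [K] places of its block. *)
Lemma slot_count i : K * (slot i).1 + (slot i).2 <= i + K * count f (iota 0 i) + 1.
Proof.
elim: i => [|i IH]; first by rewrite muln0.
rewrite -addn1 iotaD count_cat /= addn1 /= add0n addn0.
have := slot_rank i; move: IH; case: (slot i) => b j /= IH h.
by case: ifP => [/orP[/eqP E|->]|_] /=; nia.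
Qed.

End Slots.

Section Rows.
Variables (T : finType) (e : rel T) (K : nat) (s : seq T).
Hypotheses (e_sym : symmetric e) (K0 : 0 < K) (us : uniq s) (s_all : forall x, x \in s).

Let flag i := if onth s i is Some v then full e s v else false.
Let sl v := slot K flag (index v s).

(** Ranks run from 1 to [K], so within the [K.+2] rows of a block offset 0 is the shared row and
    offset [K + 1] is never a vertex row. *)
Definition vrow v := (sl v).1 * K.+2 + (sl v).2.

Definition block_row v := (sl v).1 * K.+2.

Let rank v : 0 < (sl v).2 <= K. Proof. exact: slot_rank. Qed.

Lemma row_lt u v : index u s < index v s -> vrow u < vrow v.
Proof.
move=> h; rewrite /vrow /sl; have := rank u; have := rank v; rewrite /sl.
by have [|[_ -> ]] := @slot_lt K flag K0 _ _ h; nia.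
Qed.

Lemma row_ltE u v : (vrow u < vrow v) = (index u s < index v s).
Proof.
case: (ltngtP (index u s) (index v s)) => h; first exact: row_lt.
  by apply/negbTE; rewrite -leqNgt ltnW // row_lt.
by rewrite /vrow /sl h ltnn.
Qed.

Lemma row_inj : injective vrow.
Proof.
move=> u v E; have : index u s = index v s.
  by have := row_ltE u v; have := row_ltE v u; rewrite E ltnn; lia.
by move=> E'; rewrite -(nth_index u (s_all u)) E' nth_index.
Qed.

Lemma block_rowP v : block_row v < vrow v <= block_row v + K.
Proof. by rewrite /vrow /block_row; have := rank v; lia. Qed.

Lemma block_row_lt u v : block_row u < block_row v -> block_row u + K.+2 <= block_row v.
Proof. by rewrite /block_row ltn_pmul2r // -mulSnr leq_pmul2r. Qed.

Lemma predecessors v : #|[pred u | upward e vrow u v]| = deg_in e (before s v) v.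
Proof.
rewrite /deg_in; apply: eq_card => u; by rewrite !inE /upward row_ltE in_take // andbC.
Qed.

Lemma row_full_last v : #|[pred u | upward e vrow u v]| = 4 ->
  forall w, block_row w = block_row v -> vrow w <= vrow v.
Proof.
rewrite predecessors => h w E; rewrite leqNgt row_ltE; apply/negP => lt.
have := @slot_lt K flag K0 _ _ lt.
rewrite -/(sl v) -/(sl w).
rewrite /flag; have -> : onth s (index v s) = Some v.
  by rewrite onthE (nth_map v) ?index_mem // nth_index.
by move: E; rewrite /block_row /full h eqxx => E [|[]] //; nia.
Qed.

(** The vertices below row [r] form a prefix of the order, and the active edges are those leaving
    it. *)
Lemma active_cut r : exists k, #|[pred p : T * T | active e vrow r p.1 p.2]| = cut e [set u in take k s].
Proof.
exists (find (fun u => r <= vrow u) s).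
have pre u : (u \in take (find (fun u => r <= vrow u) s) s) = (vrow u < r).
  rewrite in_take //; apply/idP/idP => h.
    by have := before_find u h; rewrite nth_index // => /negbT; rewrite -ltnNge.
  rewrite ltnNge; apply/negP => h'.
  have hs : has (fun u => r <= vrow u) s.
    by rewrite has_find; apply: leq_ltn_trans h' _; rewrite index_mem.
  have := nth_find u hs; apply/negP; rewrite -ltnNge; apply: leq_ltn_trans h.
  rewrite leqNgt row_ltE index_uniq -?has_find // -leqNgt //.
rewrite /cut /deg_in; under eq_bigr do rewrite -sum1_card.
rewrite -sum1_card pair_big_dep /= [RHS](reindex (fun p : T * T => (p.2, p.1))) /=.
  apply: eq_bigl => -[u w]; rewrite !inE /= !pre /active /upward -leqNgt.
  by case: (e u w); rewrite ?andbF //=; apply/idP/idP; lia.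
by exists (fun p : T * T => (p.2, p.1)) => -[].
Qed.

Lemma row_bound v : (vrow v).+1 < K.+2 * ((size s + K * count (full e s) s) %/ K).+1.
Proof.
have iv : index v s < size s by rewrite index_mem.
have cf : count flag (iota 0 (size s)) = count (full e s) s.
  rewrite -[X in _ = count _ X](mkseq_nth v s) count_map; apply: eq_in_count => i.
  by rewrite mem_iota /= /flag => hi; rewrite onthE (nth_map v).
have ci : count flag (iota 0 (index v s)) <= count flag (iota 0 (size s)).
  by rewrite -(subnKC (ltnW iv)) iotaD count_cat leq_addr.
have := @slot_count K flag K0 (index v s); rewrite -/(sl v) => h.
have hb : (sl v).1 <= (size s + K * count (full e s) s) %/ K.
  rewrite leq_divRL //; have := rank v; nia.
by rewrite /vrow; have := rank v; nia.
Qed.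

End Rows.

(** * The area estimate *)

Lemma three_connected_connect (T : finType) (e : rel T) : three_connected e ->
  forall x y, connect e x y.
Proof.
move=> [n3 conn] x y.
have [u] : exists u, u \in ~: [set x; y].
  by apply/set0Pn; rewrite -card_gt0; have := cardsC [set x; y]; rewrite cards2; lia.
rewrite !inE negb_or => /andP[ux uy].
(* The third vertex [u] plays both deleted vertices. *)
apply: (connect_sub _ (conn u u x y _ _ _ _)); try by rewrite eq_sym.
by move=> a b /andP[h _]; exact: connect1.
Qed.

(** [F] counts the vertices with four earlier neighbours, each of which may leave a block partly
    empty. The two factors of the bound are rows and columns. *)
Lemma drawing_exists (R : realType) (T : finType) (e : rel T) (K m : nat) :
  simple_graph e -> max_degree_le e 4 -> (forall x y, connect e x y) ->
  1 < #|T| -> 0 < K -> m <= #|T| ->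
  exists pos route F, [/\ orth_drawing R e pos route, F * m <= #|T| &
    drawing_area e pos route <= K.+2 * ((#|T| + K * F) %/ K).+1 *
      ((2 * #|T| + 12 * (4 * m + 1) + 8) %/ 3 + 4 * K)].
Proof.
move=> [e_sym e_irr] deg conn n1 K0 hm.
have [s gs s_all] := greedy_exists e_sym deg conn n1 hm.
have us := gr_uniq gs.
have ss : size s = #|T|.
  by rewrite -(card_uniqP us); apply: eq_card => x; rewrite s_all.
set W := _ %/ 3 + _.
have cutW (r : nat) : #|[pred p : T * T | active e (vrow e K s) r p.1 p.2]| + 4 * K <= W.
  have [k ->] : exists k, #|[pred p : T * T | active e (vrow e K s) r p.1 p.2]| = cut e [set u in take k s].
    exact: active_cut.
  by rewrite leq_add2r leq_divRL // mulnC; exact: gr_cuts gs k.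
have y_inj : injective (vrow e K s) by exact: row_inj.
have y_block v : block_row e K s v < vrow e K s v <= block_row e K s v + K by exact: block_rowP.
have y_lt u v : block_row e K s u < block_row e K s v ->
  block_row e K s u + K.+2 <= block_row e K s v by exact: block_row_lt.
have y_full v : #|[pred u | upward e (vrow e K s) u v]| = 4 ->
  forall w, block_row e K s w = block_row e K s v -> vrow e K s w <= vrow e K s v.
  by exact: row_full_last.
have [X [C [P [Win [L X_lt C_lt]]]]] :=
  layout_exists e_sym e_irr deg y_inj y_block y_lt y_full cutW.
exists (pos (vrow e K s) X), (route (vrow e K s) (block_row e K s) X C P), (count (full e s) s).
split; first exact: layout_drawing L.
  by rewrite -ss; exact: gr_full gs.
apply: (layout_area e_sym e_irr L) => //.
- by rewrite /W; lia.
- by move=> v; rewrite -ss; exact: row_bound.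
Qed.

(** Multiplying the hypotheses bounds 72 H W; the constant term [a * b] is absorbed into the linear
    one because n is positive. *)
Lemma area_bound (R : realType) (H W n a b : nat) : 24 * H <= 25 * n + a -> 3 * W <= 2 * n + b ->
  0 < n ->
  ((H * W)%N%:R <= 25 / 36 * n%:R ^+ 2 + (25 * b + 2 * a + a * b)%N%:R / 72 * n%:R :> R)%R.
Proof.
move=> h1 h2 n0.
have h : 72 * (H * W) <= 50 * (n * n) + (25 * b + 2 * a + a * b) * n.
  have := leq_mul h1 h2; nia.
move: h; rewrite -(ler_nat R) !natrM natrD !natrM.
set c := ((_ + _)%N%:R)%R; move: (n%:R)%R (H%:R)%R (W%:R)%R => x y z; lra.
Qed.

Local Open Scope ring_scope.

Theorem theorem1 (R : realType) :
  exists c : R,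
    forall (T : finType) (e : rel T),
      simple_graph e -> three_connected e -> max_degree_le e 4 ->
      exists (pos : T -> gpoint) (route : T -> T -> seq gpoint),
        orth_drawing R e pos route /\
        ((drawing_area e pos route)%:R : R)
          <= 25 / 36 * (#|T|%:R) ^+ 2 + c * #|T|%:R.
Proof.
(* For these values both (K + 2) / K - 1 and (K + 2) / L are 1/48. *)
pose K := 96%N; pose L := (98 * 48)%N.
(* The additive constants in 24 H <= 25 n + [a] and 3 W <= 2 n + [b]. *)
pose a := L; pose b := (12 * (4 * L + 1) + 8 + 12 * K)%N.
exists ((25 * b + 2 * a + a * b)%N%:R / 72) => T e simple conn3 deg.
have n3 := conn3.1; have conn := three_connected_connect conn3.
(* The minimum serves graphs with fewer than [L] vertices, where no component can have [L] of
   them. *)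
have [|||pos [route [F [draw full_le area_le]]]] :=
  @drawing_exists R T e K (minn L #|T|) simple deg conn; rewrite ?geq_minr //.
  exact: ltn_trans n3.
exists pos, route; split=> //.
apply: le_trans (@area_bound R _ _ #|T| a b _ _ _); first by rewrite ler_nat; exact: area_le.
(* For n at most [L] the bound [F * n <= n] gives [F <= 1]; otherwise [F * L <= n]. *)
- have full_few : (L * F <= #|T| + L)%N.
    by move: full_le; rewrite /minn; case: ltnP => ?; nia.
  have := leq_divM (#|T| + K * F) K; rewrite /a /L /K in full_few *; lia.
- have := leq_divM (2 * #|T| + 12 * (4 * minn L #|T| + 1) + 8) 3.
  have := geq_minl L #|T|; rewrite /b /L /K; lia.
- exact: ltn_trans n3.
Qed.
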